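(* There exist universal constants $K<\infty$ and $L<\infty$ such that, if $n\in\mathbb{N}$ and $h_{i,j}:S^2\to\mathbb{R}$, $i,j=1,\dots,n$, are bounded canonical kernels of two variables for the independent random variables $X_i^{(1)},X_j^{(2)}$, $i,j=1,\dots,n$, and if $A,B,C,D\ge0$ are defined by $$A=\max_{i,j}\|h_{i,j}\|_\infty,\qquad C^2=\sum_{i,j}Eh_{i,j}^2(X_i^{(1)},X_j^{(2)}),$$ $$B^2=\max\Bigl[\max_j\Bigl\|\sum_iE_1h_{i,j}^2(X_i^{(1)},y)\Bigr\|_\infty,\ \max_i\Bigl\|\sum_jE_2h_{i,j}^2(x,X_j^{(2)})\Bigr\|_\infty\Bigr],$$ $$D=\sup\Bigl\{E\sum_{i,j}h_{i,j}(X_i^{(1)},X_j^{(2)})f_i(X_i^{(1)})g_j(X_j^{(2)}):\ E\sum_if_i^2(X_i^{(1)})\le1,\ E\sum_jg_j^2(X_j^{(2)})\le1\Bigr\},$$ then $$E\Bigl|\sum_{1\le i,j\le n}h_{i,j}(X_i^{(1)},X_j^{(2)})\Bigr|^p\le K^p\bigl[p^{p/2}C^p+p^pD^p+p^{3p/2}B^p+p^{2p}A^p\bigr]$$ for all $p\ge2$ and, equivalently, $$\Pr\Bigl\{\Bigl|\sum_{i,j\le n}h_{i,j}(X_i^{(1)},X_j^{(2)})\Bigr|\ge x\Bigr\}\le L\exp\Bigl[-\frac1L\min\Bigl(\frac{x^2}{C^2},\frac xD,\frac{x^{2/3}}{B^{2/3}},\frac{x^{1/2}}{A^{1/2}}\Bigr)\Bigr]$$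 for all $x>0$.
   Context: The random variables $X_i^{(1)},X_j^{(2)}$, $1\le i,j\le n$, are all independent (not necessarily identically distributed) with values in a measurable space $(S,\mathcal{S})$; kernels are measurable. $E$ is expectation with respect to all variables, and $E_1$ (resp. $E_2$) is expectation only with respect to the variables $X_i^{(1)}$ (resp. $X_j^{(2)}$), the others being held fixed. The kernels are canonical (completely degenerate) if $E_1h_{i,j}(X_i^{(1)},X_j^{(2)})=0$ a.s. and $E_2h_{i,j}(X_i^{(1)},X_j^{(2)})=0$ a.s. for all $i,j$. $\|\cdot\|_\infty$ is the supremum norm (of a function on $S^2$, or of a function of $y\in S$, resp. of $x\in S$). The supremum defining $D$ is over measurable functions $f_i,g_j:S\to\mathbb{R}$. Fractions with zero denominator are interpreted as $+\infty$. *)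

(* Defs.v *)
From HB Require Import structures.
From mathcomp Require Import all_boot all_order all_algebra.
From mathcomp Require Import all_classical all_reals all_analysis.

Set Implicit Arguments.
Unset Strict Implicit.
Unset Printing Implicit Defensive.

Import Order.TTheory GRing.Theory Num.Theory.
Import numFieldNormedType.Exports.

Local Open Scope classical_set_scope.
Local Open Scope ring_scope.

Definition mutually_independent (R : realType) (d d' : measure_display)
    (Omega : measurableType d) (S : measurableType d')
    (P : probability Omega R) (I : finType) (X : I -> {RV P >-> S}) : Prop :=
  forall (J : {set I}) (B : I -> set S), (forall i, measurable (B i)) ->
    P (\bigcap_(i in [set` J]) (X i @^-1` B i)) =
    (\prod_(i in J) P (X i @^-1` B i))%E.

(* The genuine supremum of |f| over all of T, not an essential supremum. *)
Definition supnorm (R : realType) (T : Type) (f : T -> \bar R) : \bar R :=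
  ereal_sup (range (fun x => `|f x|%E)).

Section Kernels.
Context (R : realType) (d d' : measure_display).
Context (Omega : measurableType d) (S : measurableType d').
Context (P : probability Omega R) (n : nat).
Context (X1 X2 : 'I_n -> {RV P >-> S}).
Context (h : 'I_n -> 'I_n -> S * S -> R).

Definition family12 (k : 'I_n + 'I_n) : {RV P >-> S} :=
  match k with inl i => X1 i | inr j => X2 j end.

Definition bounded_kernels : Prop :=
  forall i j, exists M : R, forall z, `|h i j z| <= M.

(* E_1 and E_2 integrate one variable out, the other being held fixed; by
   independence this is integration against the marginal law of that variable. *)
Definition E1 (i : 'I_n) (u : S -> R) : \bar R := 'E_P[fun w => u (X1 i w)].

Definition E2 (j : 'I_n) (u : S -> R) : \bar R := 'E_P[fun w => u (X2 j w)].

Definition canonical_kernels : Prop := forall i j,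
  {ae P, forall w, E1 i (fun x => h i j (x, X2 j w)) = 0%E} /\
  {ae P, forall w, E2 j (fun y => h i j (X1 i w, y)) = 0%E}.

Definition Ustat (w : Omega) : R :=
  \sum_(i < n) \sum_(j < n) h i j (X1 i w, X2 j w).

(* The four parameters live in \bar R, so that no default value can interfere
   with the suprema and with the division by zero below. *)
Local Open Scope ereal_scope.

Definition paramA : \bar R :=
  \big[maxe/0]_(i < n) \big[maxe/0]_(j < n) supnorm (EFin \o h i j).

Definition paramC : \bar R :=
  sqrte (\sum_(i < n) \sum_(j < n) 'E_P[fun w => (h i j (X1 i w, X2 j w) ^+ 2)%R]).

Definition paramB : \bar R :=
  sqrte (maxe
    (\big[maxe/0]_(j < n)
       supnorm (fun y : S => \sum_(i < n) E1 i (fun x => (h i j (x, y) ^+ 2)%R)))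
    (\big[maxe/0]_(i < n)
       supnorm (fun x : S => \sum_(j < n) E2 j (fun y => (h i j (x, y) ^+ 2)%R)))).

Definition paramD : \bar R :=
  ereal_sup [set z | exists f g : 'I_n -> S -> R,
    [/\ (forall i, measurable_fun setT (f i)) /\
        (forall j, measurable_fun setT (g j)),
        'E_P[fun w => (\sum_(i < n) f i (X1 i w) ^+ 2)%R] <= 1,
        'E_P[fun w => (\sum_(j < n) g j (X2 j w) ^+ 2)%R] <= 1 &
        z = 'E_P[fun w => (\sum_(i < n) \sum_(j < n)
              h i j (X1 i w, X2 j w) * f i (X1 i w) * g j (X2 j w))%R] ]].

Definition moment_bound (p : R) : \bar R :=
  (p `^ (p / 2))%:E * paramC `^ p + (p `^ p)%:E * paramD `^ p
  + (p `^ (3 * p / 2))%:E * paramB `^ p + (p `^ (2 * p))%:E * paramA `^ p.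

(* In \bar R, 0^-1 = +oo, hence x / 0 = +oo for x > 0, and expeR -oo = 0. *)
Definition tail_rate (x : R) : \bar R :=
  mine (mine ((x ^+ 2)%:E / paramC ^+ 2) (x%:E / paramD))
       (mine ((x `^ (2 / 3))%:E / paramB `^ (2 / 3))
             ((x `^ (1 / 2))%:E / paramA `^ (1 / 2))).

End Kernels.

(* Main.v *)
(** [U = sum_{i,j} h_{i,j}(X_i, Y_j)] is handled through its moments of order [m = 4r]
    (here [X = X^(1)] and [Y = X^(2)]).

    For independent centred [Z_k], expanding [E (sum_k Z_k)^m] one variable at a time
    gives [|E (sum Z)^m| <= m! T^m exp (2 beta)] as soon as
    [sum_k |E Z_k^l| <= beta T^l] for all [1 <= l <= m]; this contains both
    Bernstein's inequality and Rosenthal's with the constants [sqrt m] and [m].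

    Rosenthal's inequality given the [X_i] bounds [E U^m] by the moments of
    [V = sum_j E_2 (sum_i h_{i,j}(X_i, .))^2] and by [sum_j E |sum_i h_{i,j}|^m]; the
    latter is again controlled by Rosenthal's inequality, now given the [Y_j].

    [V] is the squared norm of a sum of independent centred vectors of a Hilbert
    space, [V = sum_{i,k} <v_i, v_k>].  No empirical process theory is needed to bound
    its moments: the diagonal is a sum of independent nonnegative variables, and the
    off-diagonal part is the average over subsets [I] of
    [4 <sum_{i in I} v_i, sum_{k notin I} v_k>].  Given the second factor [w], this is a
    sum of independent centred scalars bounded by [B |w|] with variance at most
    [D^2 |w|^2], so Bernstein's inequality bounds its moments by those of [|w|^2],
    which is itself a [V] over a smaller index set.  This yields a quadratic inequality for the
    largest of these moments, solved by the arithmetic-geometric mean inequality.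

    Real exponents follow by interpolation, the tail bound by Markov's inequality
    with [m] proportional to the rate. *)

Require Import Defs.
From mathcomp Require Import all_boot all_order all_algebra.
From mathcomp Require Import all_classical all_reals all_analysis.
From mathcomp Require Import measurable_realfun.
From mathcomp Require Import ring lra zify.

Set Implicit Arguments.
Unset Strict Implicit.
Unset Printing Implicit Defensive.

Import Order.TTheory GRing.Theory Num.Theory.
Import numFieldNormedType.Exports.

Local Open Scope classical_set_scope.
Local Open Scope ring_scope.

(** * Bounded measurable functions *)

Section BoundedMeasurable.
Context {R : realType} {d : measure_display} {T : measurableType d}.
Implicit Types f g : T -> R.

(** The kernels are bounded, so the random variables estimated below stay in this class; it is
    stable under sums, products and partial means, and integrability comes for free. *)
Definition bmeas f := measurable_fun setT f /\ exists M, forall x, `|f x| <= M.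

Lemma bmeas_cst (c : R) : bmeas (fun=> c).
Proof. by split; [exact: measurable_cst|exists `|c|]. Qed.

Lemma bmeasD f g : bmeas f -> bmeas g -> bmeas (fun x => f x + g x).
Proof.
move=> [mf [M fM]] [mg [N gN]]; split; first exact: measurable_funD.
by exists (M + N) => x; rewrite (le_trans (ler_normD _ _))// lerD.
Qed.

Lemma bmeasM f g : bmeas f -> bmeas g -> bmeas (fun x => f x * g x).
Proof.
move=> [mf [M fM]] [mg [N gN]]; split; first exact: measurable_funM.
by exists (M * N) => x; rewrite normrM ler_pM.
Qed.

Lemma bmeasZ (c : R) f : bmeas f -> bmeas (fun x => c * f x).
Proof. by apply: bmeasM; exact: bmeas_cst. Qed.

Lemma bmeasX f m : bmeas f -> bmeas (fun x => f x ^+ m).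
Proof.
move=> bf; elim: m => [|m IH]; first exact: bmeas_cst.
by under eq_fun do rewrite exprS; exact: bmeasM.
Qed.

Lemma bmeas_norm f : bmeas f -> bmeas (fun x => `|f x|).
Proof.
move=> [mf [M fM]]; split; first exact: measurableT_comp.
by exists M => x; rewrite normr_id.
Qed.

Lemma bmeas_sum I (r : seq I) (Q : pred I) (F : I -> T -> R) :
  (forall i, bmeas (F i)) -> bmeas (fun x => \sum_(i <- r | Q i) F i x).
Proof.
move=> bF; elim: r => [|i r IH].
  by under eq_fun do rewrite big_nil; exact: bmeas_cst.
under eq_fun do rewrite big_cons.
by case: (Q i) => //; exact: bmeasD.
Qed.

End BoundedMeasurable.

Lemma bmeas_comp (R : realType) d d' (T : measurableType d)
    (T' : measurableType d') (g : T' -> T) (f : T -> R) :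
  bmeas f -> measurable_fun setT g -> bmeas (fun x => f (g x)).
Proof.
move=> [mf [M fM]] mg; split; [exact: measurableT_comp|by exists M => x].
Qed.

(** * Means of bounded measurable functions, as real numbers *)

Section Mean.
Context {R : realType} {d : measure_display} {T : measurableType d}.
Variable P : probability T R.
Implicit Types f g : T -> R.

Lemma bmeas_integrable f : bmeas f -> P.-integrable setT (EFin \o f).
Proof.
move=> [mf [M fM]]; apply: measurable_bounded_integrable => //.
  by rewrite (le_lt_trans (probability_le1 _ _))// ltry.
exists M; split; first by rewrite num_real.
by move=> t Mt x _; exact: le_trans (fM x) (ltW Mt).
Qed.

Lemma EFin_mean f : bmeas f -> (\int[P]_x f x)%:E = (\int[P]_x (f x)%:E)%E.
Proof.
by move=> bf; rewrite fineK// (integrable_fin_num _ (bmeas_integrable bf)).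
Qed.

Lemma expectation_mean f : bmeas f -> ('E_P[f] = (\int[P]_x f x)%R%:E)%E.
Proof. by move=> bf; rewrite unlock EFin_mean. Qed.

Lemma mean_cst c : \int[P]_x c = c.
Proof. by rewrite Rintegral_cst// [X in fine X](probability_setT P) mulr1. Qed.

Lemma meanD f g : bmeas f -> bmeas g ->
  \int[P]_x (f x + g x) = \int[P]_x f x + \int[P]_x g x.
Proof. by move=> bf bg; rewrite RintegralD//; exact: bmeas_integrable. Qed.

Lemma meanZ c f : bmeas f -> \int[P]_x (c * f x) = c * \int[P]_x f x.
Proof. by move=> bf; rewrite RintegralZl//; exact: bmeas_integrable. Qed.

Lemma meanZr c f : bmeas f -> \int[P]_x (f x * c) = (\int[P]_x f x) * c.
Proof. by move=> bf; rewrite RintegralZr//; exact: bmeas_integrable. Qed.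

Lemma mean_sum I (r : seq I) (Q : pred I) (F : I -> T -> R) :
  (forall i, bmeas (F i)) ->
  \int[P]_x (\sum_(i <- r | Q i) F i x) = \sum_(i <- r | Q i) \int[P]_x F i x.
Proof.
move=> bF; elim: r => [|i r IH].
  by under eq_fun do rewrite big_nil; rewrite big_nil mean_cst.
under eq_fun do rewrite big_cons.
rewrite big_cons; case: (Q i) => //.
by rewrite meanD// ?IH//; exact: bmeas_sum.
Qed.

Lemma mean_ge0 f : (forall x, 0 <= f x) -> 0 <= \int[P]_x f x.
Proof. by move=> f0; exact: Rintegral_ge0. Qed.

(** Adding a common bound [c] makes both functions nonnegative, which reduces to monotonicity of the
    integral of nonnegative functions. *)
Lemma ae_le_mean f g : bmeas f -> bmeas g -> {ae P, forall x, f x <= g x} ->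
  \int[P]_x f x <= \int[P]_x g x.
Proof.
move=> bf bg fg; have [mf [M fM]] := bf; have [mg [N gN]] := bg.
pose c := Num.max M N.
have bfc : bmeas (fun x => f x + c) by exact/bmeasD/bmeas_cst.
have bgc : bmeas (fun x => g x + c) by exact/bmeasD/bmeas_cst.
have fc x : 0 <= f x + c.
  have : - f x <= c by rewrite (le_trans (ler_norm _))// normrN le_max fM.
  by rewrite lerNl -subr_ge0 opprK.
have gc x : 0 <= g x + c.
  have : - g x <= c by rewrite (le_trans (ler_norm _))// normrN le_max gN orbT.
  by rewrite lerNl -subr_ge0 opprK.
rewrite -(lerD2r c) -[in leLHS](mean_cst c) -[in leRHS](mean_cst c).
rewrite -!meanD//; try exact: bmeas_cst.
rewrite -lee_fin !EFin_mean//; apply: ae_ge0_le_integral => //.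
- by move=> x _; rewrite lee_fin.
- by apply/measurable_EFinP; case: bfc.
- by move=> x _; rewrite lee_fin.
- by apply/measurable_EFinP; case: bgc.
- by apply: filterS fg => x fgx _; rewrite lee_fin lerD2r.
Qed.

Lemma le_mean f g : bmeas f -> bmeas g -> (forall x, f x <= g x) ->
  \int[P]_x f x <= \int[P]_x g x.
Proof. by move=> bf bg fg; apply: ae_le_mean => //; exact: aeW. Qed.

Lemma ae_eq_mean f g : bmeas f -> bmeas g -> {ae P, forall x, f x = g x} ->
  \int[P]_x f x = \int[P]_x g x.
Proof.
move=> bf bg fg; apply/eqP; rewrite eq_le !ae_le_mean//;
  by apply: filterS fg => x ->.
Qed.

Lemma norm_mean_le f : bmeas f -> `|\int[P]_x f x| <= \int[P]_x `|f x|.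
Proof. by move=> bf; apply: le_normr_Rintegral => //; exact: bmeas_integrable. Qed.

End Mean.

(** * Product spaces and Fubini's theorem for bounded functions *)

Lemma bmeas_slice1 {R : realType} {d1 d2 : measure_display}
    {T1 : measurableType d1} {T2 : measurableType d2} (F : T1 * T2 -> R) y :
  bmeas F -> bmeas (fun x => F (x, y)).
Proof. by move=> bF; apply: (bmeas_comp bF). Qed.

Lemma bmeas_slice2 {R : realType} {d1 d2 : measure_display}
    {T1 : measurableType d1} {T2 : measurableType d2} (F : T1 * T2 -> R) x :
  bmeas F -> bmeas (fun y => F (x, y)).
Proof. by move=> bF; apply: (bmeas_comp bF). Qed.

(** Both measures have mass 1, so the iterated integral of [|F|] is at most the bound [M] of [F]. *)
Lemma bmeas_integrableX {R : realType} {d1 d2 : measure_display}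
    {T1 : measurableType d1} {T2 : measurableType d2}
    (P1 : probability T1 R) (P2 : probability T2 R) (F : T1 * T2 -> R) :
  bmeas F -> (P1 \x P2)%E.-integrable setT (EFin \o F).
Proof.
move=> bF; have [mF [M FM]] := bF.
apply/integrable12ltyP; first exact/measurable_EFinP.
apply: (@le_lt_trans _ _ M%:E); last by rewrite ltry.
have F1 x : (\int[P2]_y `|(EFin \o F) (x, y)| <= M%:E)%E.
  apply: (@le_trans _ _ (\int[P2]_y M%:E)%E); last first.
    by rewrite integral_cst// [X in (_ * X)%E]probability_setT mule1.
  apply: ge0_le_integral => //.
  - apply: measurableT_comp => //; apply/measurable_EFinP.
    by have [] := bmeas_slice2 x bF.
  - by move=> y _ /=; rewrite lee_fin.
apply: (@le_trans _ _ (\int[P1]_x M%:E)%E); last first.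
  by rewrite integral_cst// [X in (_ * X)%E]probability_setT mule1.
apply: ge0_le_integral => //.
- by move=> x _; exact: integral_ge0.
- apply: (measurable_fun_fubini_tonelli_F (abse \o (EFin \o F))) => //=.
  by apply: measurableT_comp => //; exact/measurable_EFinP.
Qed.

Section Fubini.
Context {R : realType} {d1 d2 : measure_display}.
Context {T1 : measurableType d1} {T2 : measurableType d2}.
Variables (P1 : probability T1 R) (P2 : probability T2 R).

(* Measurability of the partial means does not depend on the other measure, hence the
   Dirac masses, which only serve to invoke Fubini's theorem. *)
Lemma bmeas_mean2 (F : T1 * T2 -> R) :
  bmeas F -> bmeas (fun x => \int[P2]_y F (x, y)).
Proof.
move=> bF; have [mF [M FM]] := bF; split.
  apply: measurableT_comp => //.
  exact: (measurable_fubini_F (bmeas_integrableX (dirac point) P2 bF)).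
exists M => x; have bFx := bmeas_slice2 x bF.
rewrite (le_trans (norm_mean_le _ bFx))// -[leRHS](mean_cst P2).
by apply: le_mean => //; [exact: bmeas_norm|exact: bmeas_cst].
Qed.

Lemma bmeas_mean1 (F : T1 * T2 -> R) :
  bmeas F -> bmeas (fun y => \int[P1]_x F (x, y)).
Proof.
move=> bF; have [mF [M FM]] := bF; split.
  apply: measurableT_comp => //.
  exact: (measurable_fubini_G (bmeas_integrableX P1 (dirac point) bF)).
exists M => y; have bFy := bmeas_slice1 y bF.
rewrite (le_trans (norm_mean_le _ bFy))// -[leRHS](mean_cst P1).
by apply: le_mean => //; [exact: bmeas_norm|exact: bmeas_cst].
Qed.

Lemma mean_swap (F : T1 * T2 -> R) : bmeas F ->
  \int[P1]_x \int[P2]_y F (x, y) = \int[P2]_y \int[P1]_x F (x, y).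
Proof.
move=> bF; apply: EFin_inj; rewrite !EFin_mean.
- under eq_integral do rewrite (EFin_mean P2 (bmeas_slice2 _ bF)).
  under [RHS]eq_integral do rewrite (EFin_mean P1 (bmeas_slice1 _ bF)).
  exact: (Fubini (bmeas_integrableX P1 P2 bF)).
- exact: bmeas_mean1.
- exact: bmeas_mean2.
Qed.

End Fubini.

(** * Product sigma-algebra on finitely many coordinates *)

Section CoordinateSpace.
Context (K : finType) (d : measure_display) (S : measurableType d).

Definition cylinder (B : K -> set S) : set (K -> S) :=
  [set x | forall k, B k (x k)].

Definition cylinders : set (set (K -> S)) :=
  [set A | exists2 B, (forall k, measurable (B k)) & A = cylinder B].

(* The product sigma-algebra on S^K. *)
Definition vect := g_sigma_algebraType cylinders.

Lemma measurable_coord (k : K) : measurable_fun setT (fun x : vect => x k).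
Proof.
move=> _ B mB; rewrite setTI; apply: sub_sigma_algebra.
exists (fun k' => if k' == k then B else setT).
  by move=> k'; case: ifP.
apply/seteqP; split=> [x /= Bx k'|x /= /(_ k)].
  by case: eqP => // ->.
by rewrite eqxx.
Qed.

Lemma measurable_vect d' (T : measurableType d') (f : T -> vect) :
  (forall k, measurable_fun setT (fun w => f w k)) -> measurable_fun setT f.
Proof.
move=> mf; apply: (measurability cylinders (f := f)) => // _ [_ [B mB ->] <-].
rewrite setTI.
rewrite (_ : f @^-1` cylinder B = \bigcap_(k in [set: K]) (f ^~ k @^-1` B k)); last
  first.
  by apply/seteqP; split=> [w /= Bw k _|w /= Bw k]; [exact: Bw|exact: Bw k I].
apply: fin_bigcap_measurable => // k _.
by rewrite -[X in measurable X]setTI; exact: mf.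
Qed.

(** The cylinders form a pi-system, so a probability on [vect] is determined by its values on
    them. *)
Lemma setI_closed_cylinders : setI_closed cylinders.
Proof.
move=> _ _ [B mB ->] [C mC ->]; exists (fun k => B k `&` C k).
  by move=> k; exact: measurableI.
apply/seteqP; split=> [x [Bx Cx] k|x BCx]; first by split.
by split=> k; have [] := BCx k.
Qed.

Lemma cylindersT : cylinders setT.
Proof. by exists (fun=> setT) => //; apply/seteqP; split. Qed.

End CoordinateSpace.

(** * Replacing a block of independent variables by an independent copy *)

Section Decoupling.
Context {R : realType} {d d' : measure_display}.
Context {Omega : measurableType d} {S : measurableType d'}.
Variables (P : probability Omega R) (K : finType) (X : K -> {RV P >-> S}).
Hypothesis indX : mutually_independent X.

(** This plays the role of conditioning on the coordinates in [I]: the others are read at a second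
    sample point [v]. By independence, the law of the family and that of the mixed family on
    [Omega * Omega] agree on cylinders, hence everywhere. *)
Lemma decouple (I : {set K}) (F : vect K S -> R) : bmeas F ->
  \int[P]_w F (fun k => X k w) =
  \int[P]_w \int[P]_v F (fun k => if k \in I then X k w else X k v).
Proof.
move=> bF; have [mF _] := bF.
pose Y0 (w : Omega) : vect K S := fun k => X k w.
pose Z0 (z : Omega * Omega) : vect K S :=
  fun k => if k \in I then X k z.1 else X k z.2.
have mY0 : measurable_fun setT Y0 by apply: measurable_vect => k.
have mZ0 : measurable_fun setT Z0.
  apply: measurable_vect => k; rewrite /Z0.
  by case: (k \in I); apply: measurableT_comp => //.
pose Y : {mfun Omega >-> vect K S} := mfun_Sub (mem_set mY0).
pose Z : {mfun (Omega * Omega)%type >-> vect K S} := mfun_Sub (mem_set mZ0).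
have mX k (B : set S) : measurable B -> measurable (X k @^-1` B).
  by move=> mB; rewrite -[X in measurable X]setTI; exact: measurable_funP.
have law A : measurable A ->
    distribution P Y A = distribution (P \x P)%E Z A.
  apply: (@measure_unique _ _ (vect K S) (@cylinders K _ S) (fun=> setT) erefl
    _ _ _ (distribution P Y) (distribution (P \x P)%E Z)) => //.
  - exact: setI_closed_cylinders.
  - by move=> _; exact: cylindersT.
  - by rewrite bigcup_const//; exists 0%N.
  - move=> _ [B mB ->]; change (P (Y0 @^-1` cylinder B) = (P \x P)%E (Z0 @^-1`
    cylinder B)).
    have -> : Y0 @^-1` cylinder B =
        \bigcap_(k in [set` [set: K]%SET]) (X k @^-1` B k).
      apply/seteqP; split=> [w /= Bw k _|w /= Bw k]; first exact: Bw.
      by apply: Bw => /=; rewrite inE.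
    (* Under the mixed family a cylinder pulls back to a rectangle, whose product measure splits
       into the factors over [I] and over its complement. *)
    have -> : Z0 @^-1` cylinder B =
        (\bigcap_(k in [set` I]) (X k @^-1` B k)) `*`
        (\bigcap_(k in [set` ~: I]) (X k @^-1` B k)).
      apply/seteqP; split=> [[w v] /= Bwv|[w v] /= [Bw Bv] k].
        split=> k /= kI; have := Bwv k; rewrite /Z0 /= ?kI//.
        by move: kI; rewrite inE => /negPf ->.
      rewrite /Z0 /=; case: ifPn => kI; first exact: Bw.
      by apply: Bv => /=; rewrite inE.
    rewrite product_measure1E; last 2 first.
    + by apply: fin_bigcap_measurable => // k _; exact: mX.
    + by apply: fin_bigcap_measurable => // k _; exact: mX.
    pose f k : \bar R := P (X k @^-1` B k).
    have Pf (J : {set K}) :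
        P (\bigcap_(k in [set` J]) (X k @^-1` B k)) = (\prod_(k in J) f k)%E.
      exact: indX.
    rewrite [LHS]Pf [X in (X * _)%E]Pf [X in (_ * X)%E]Pf.
    transitivity (\prod_k f k)%E; first by apply: eq_bigl => k; rewrite inE.
    rewrite (bigID (mem I)) /=; congr (_ * _)%E.
    by apply: eq_bigl => k; rewrite inE.
  - by move=> _; rewrite (le_lt_trans (probability_le1 _ _))// ltry.
have bFY : bmeas (fun w => F (Y0 w)) by apply: (bmeas_comp bF).
have bFZ : bmeas (fun z => F (Z0 z)) by apply: (bmeas_comp bF).
apply: EFin_inj; rewrite (EFin_mean P bFY) (EFin_mean P (bmeas_mean2 P (F := F \o Z0)
  bFZ)).
under [RHS]eq_integral do rewrite (EFin_mean P (bmeas_slice2 (F := F \o Z0) _ bFZ)).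
have iFZ := bmeas_integrableX P P (F := F \o Z0) bFZ.
rewrite (integral12_prod_meas1 iFZ).
have mEF : measurable_fun setT (EFin \o F) by exact/measurable_EFinP.
transitivity (\int[distribution P Y]_y (F y)%:E)%E.
  by rewrite (integral_distribution mEF)//; exact: (bmeas_integrable P bFY).
rewrite -[RHS](integral_distribution (X := Z) mEF)//.
by apply: eq_measure_integral => A mA _; exact: law.
Qed.

End Decoupling.

(** * Moments of sums of independent variables: Bernstein and Rosenthal *)

Section Moments.
Context {R : realType} {d d' : measure_display}.
Context {Omega : measurableType d} {S : measurableType d'}.
Variables (P : probability Omega R) (K : finType) (X : K -> {RV P >-> S}).
Hypothesis indX : mutually_independent X.
Variable phi : K -> S -> R.
Hypothesis bphi : forall k, bmeas (phi k).

Local Notation Y k w := (phi k (X k w)).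

Let bY k : bmeas (fun w => Y k w).
Proof. exact: (bmeas_comp (bphi k)). Qed.

Let bYs s : bmeas (fun w => \sum_(k <- s) Y k w).
Proof. exact: bmeas_sum. Qed.

Lemma mean_indep (k : K) (s : seq K) (a b : nat) : k \notin s ->
  \int[P]_w (Y k w ^+ a * (\sum_(j <- s) Y j w) ^+ b) =
  (\int[P]_w Y k w ^+ a) * \int[P]_w (\sum_(j <- s) Y j w) ^+ b.
Proof.
move=> ks.
pose F (x : vect K S) : R := phi k (x k) ^+ a * (\sum_(j <- s) phi j (x j)) ^+ b.
have bc j : bmeas (fun x : vect K S => phi j (x j)).
  by apply: (bmeas_comp (bphi j)); exact: measurable_coord.
have bF : bmeas F.
  by apply: bmeasM; apply: bmeasX => //; exact: bmeas_sum.
rewrite (decouple indX [set k]%SET bF) /F /=.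
under eq_fun => w.
  under eq_fun => v.
    rewrite inE eqxx.
    under eq_big_seq => j js.
      rewrite inE (_ : (j == k) = false); last first.
        by apply: contraNF ks => /eqP <-.
      over.
    over.
  rewrite meanZ; last exact/bmeasX/bYs.
  over.
by rewrite meanZr//; exact: bmeasX.
Qed.

(** With the normalisation by [l! T^l], the binomial expansion of the moments of a sum becomes a
    plain convolution. *)
Let g (T : R) k l := `|\int[P]_w Y k w ^+ l| / (l`!%:R * T ^+ l).

(** Induction on the index sequence, for all orders [l <= m] at once: splitting off one variable
    multiplies the normalised bound by at most [1 + sum_{i >= 1} g T k i], which is at most the
    exponential of the sum. *)
Let moment_sum_le_expR (s : seq K) m T l : uniq s -> 0 < T -> (l <= m)%N ->
  `|\int[P]_w (\sum_(k <- s) Y k w) ^+ l| <=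
  l`!%:R * T ^+ l * expR (\sum_(k <- s) \sum_(1 <= i < m.+1) g T k i).
Proof.
move=> us T0 lm; elim: s us l lm => [|k s IH] /=.
  move=> _ l _; under eq_fun do rewrite big_nil.
  rewrite big_nil expR0 mulr1 mean_cst expr0n.
  case: l => [|l]; first by rewrite fact0 expr0 mulr1 normr1.
  by rewrite normr0 mulr_ge0// exprn_ge0// ltW.
move=> /andP[ks us] l lm; rewrite big_cons expRD.
set e := expR (\sum_(j <- s) _).
have e0 : 0 <= e by exact: expR_ge0.
have g0 j : 0 <= g T k j by rewrite divr_ge0// mulr_ge0// exprn_ge0// ltW.
have fT j : 0 < j`!%:R * T ^+ j by rewrite mulr_gt0 ?exprn_gt0// ltr0n fact_gt0.
have -> : \int[P]_w (\sum_(j <- k :: s) Y j w) ^+ l =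
    \sum_(i < l.+1) ((\int[P]_w Y k w ^+ (l - i)) *
                     \int[P]_w (\sum_(j <- s) Y j w) ^+ i) *+ 'C(l, i).
  under eq_fun do rewrite big_cons exprDn.
  rewrite mean_sum; last first.
    move=> i; under eq_fun do rewrite -mulr_natl.
    by apply: bmeasZ; apply: bmeasM; apply: bmeasX.
  apply: eq_bigr => i _; under eq_fun do rewrite -mulr_natl.
  rewrite meanZ; last by apply: bmeasM; exact: bmeasX.
  by rewrite mean_indep// mulr_natl.
rewrite (le_trans (ler_norm_sum _ _ _))//.
apply: (@le_trans _ _ (\sum_(i < l.+1) l`!%:R * T ^+ l * e * g T k (l - i)%N)).
  apply: ler_sum => i _; rewrite normrMn normrM -[leLHS]mulr_natl.
  have il : (i <= l)%N by rewrite -ltnS.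
  apply: (@le_trans _ _ ('C(l, i)%:R * (`|\int[P]_w Y k w ^+ (l - i)| *
      (i`!%:R * T ^+ i * e)))).
    by rewrite ler_wpM2l// ler_wpM2l// IH// (leq_trans il).
  have -> : T ^+ l = T ^+ (l - i) * T ^+ i by rewrite -exprD subnK.
  rewrite -(bin_fact il) !natrM /g.
  rewrite le_eqVlt; apply/orP; left; apply/eqP.
  have := lt0r_neq0 (fT (l - i)%N); rewrite mulf_eq0 negb_or => /andP[fn0 Tn0].
  by field; rewrite fn0 Tn0.
rewrite -mulr_sumr -!mulrA.
rewrite ler_wpM2l ?ler0n// ler_wpM2l ?exprn_ge0 ?(ltW T0)//.
rewrite [leRHS]mulrC ler_wpM2l//.
(* After reversal the term of index [i] is [g T k i]; the term of index 0 equals 1 and the orders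
   between [l] and [m] only add nonnegative terms. *)
rewrite (reindex_inj rev_ord_inj) /=.
under eq_bigr => i _ do rewrite subSS subKn -1?ltnS//.
rewrite (le_trans _ (expR_ge1Dx _))// big_ord_recl /=.
rewrite {1}/g fact0 expr0; under eq_fun do rewrite expr0.
rewrite mean_cst mul1r divr1 normr1 lerD2l.
rewrite big_add1 /= (big_cat_nat _ (n := l)) //= -[leLHS]addr0 lerD//.
  by rewrite big_mkord; apply: ler_sum => i _; rewrite /bump.
by apply: sumr_ge0.
Qed.

(** Dividing the hypothesis by [l! T^l] bounds the exponent of the previous estimate by
    [beta * sum_{l >= 1} 1 / l!], hence by [2 * beta]. *)
Lemma moment_sum_le (s : seq K) (m : nat) (T beta : R) :
  uniq s -> 0 < T -> 0 <= beta ->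
  (forall l, (0 < l <= m)%N ->
    \sum_(k <- s) `|\int[P]_w Y k w ^+ l| <= beta * T ^+ l) ->
  `|\int[P]_w (\sum_(k <- s) Y k w) ^+ m| <=
  m`!%:R * T ^+ m * expR (2 * beta).
Proof.
move=> us T0 beta0 H; rewrite (le_trans (moment_sum_le_expR us T0 (leqnn m)))//.
rewrite ler_wpM2l// ?mulr_ge0 ?exprn_ge0 ?(ltW T0)// ler_expR exchange_big /=.
apply: (@le_trans _ _ (\sum_(1 <= l < m.+1) beta * (l`!%:R)^-1)).
  rewrite big_nat_cond [leRHS]big_nat_cond; apply: ler_sum => l /andP[lm _].
  rewrite -mulr_suml ler_pdivrMr ?mulr_gt0 ?exprn_gt0 ?ltr0n ?fact_gt0//.
  by rewrite -mulrA mulKf ?H// pnatr_eq0 -lt0n fact_gt0.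
rewrite -mulr_sumr mulrC ler_wpM2r//.
case: m {H} => [|m]; first by rewrite big_geq.
(* The subtracted term makes the bound inductive, since [2 / (m+2)! <= 1 / (m+1)!]. *)
suff : \sum_(1 <= i < m.+2) i`!%:R^-1 <= 2 - (m.+1)`!%:R^-1 :> R.
  by move=> /le_trans; apply; rewrite gerBl invr_ge0.
elim: m => [|m IH]; first by rewrite big_nat1 invr1; lra.
rewrite big_nat_recr//= (le_trans (lerD IH (lexx _)))//.
have -> : (m.+2)`!%:R^-1 = m.+2%:R^-1 * (m.+1)`!%:R^-1 :> R.
  by rewrite factS natrM invfM.
have : 0 <= (m.+1)`!%:R^-1 :> R by rewrite invr_ge0.
have : (m.+2%:R)^-1 <= 2^-1 :> R by rewrite lef_pV2 ?posrE ?ltr0n// ler_nat.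
move: ((m.+2%:R)^-1 : R) ((m.+1)`!%:R^-1 : R) => u v u2 v0.
by nra.
Qed.

(** Case [beta = m]: first moments vanish, and for [l >= 2] the moment of order [l] is at most
    [T^(l-2)] times the variance. *)
Lemma bernstein_moment (s : seq K) (m : nat) (T : R) :
  uniq s -> 0 < T -> (forall k, \int[P]_w Y k w = 0) ->
  (forall k w, `|Y k w| <= T) ->
  \sum_(k <- s) \int[P]_w Y k w ^+ 2 <= m%:R * T ^+ 2 ->
  `|\int[P]_w (\sum_(k <- s) Y k w) ^+ m| <=
  m`!%:R * T ^+ m * expR (2 * m%:R).
Proof.
move=> us T0 Y0 YT Y2; apply: moment_sum_le => //; case=> [//|[_|l _]].
  rewrite big1 ?mulr_ge0 ?exprn_ge0 ?(ltW T0)//.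
  by move=> k _; under eq_fun do rewrite expr1; rewrite Y0 normr0.
rewrite -addn2 addnC exprD mulrA -ler_pdivrMr ?exprn_gt0// (le_trans _ Y2)//.
rewrite mulr_suml; apply: ler_sum => k _; rewrite ler_pdivrMr ?exprn_gt0//.
rewrite (le_trans (norm_mean_le _ _)) -?meanZr//; try exact: bmeasX.
apply: le_mean => [|| w].
- by apply/bmeas_norm/bmeasX.
- by apply: bmeasM; [exact: bmeasX|exact: bmeas_cst].
- rewrite exprD normrM !normrX real_normK ?num_real//.
  by rewrite ler_wpM2l ?sqr_ge0// lerXn2r ?nnegrE// ltW.
Qed.

(** [T] is chosen so that [T^m] is the bracket on the right; then [V <= m T^2] and [M <= T^m], and
    all orders in between follow by interpolation, with [beta = 2 m]. *)
Lemma rosenthal_moment (s : seq K) (q : nat) : uniq s -> (0 < q)%N ->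
  (forall k, \int[P]_w Y k w = 0) ->
  let m := (2 * q)%N in
  \int[P]_w (\sum_(k <- s) Y k w) ^+ m <=
  m`!%:R * expR (4 * m%:R) *
  ((\sum_(k <- s) \int[P]_w Y k w ^+ 2) ^+ q / m%:R ^+ q +
   \sum_(k <- s) \int[P]_w Y k w ^+ m).
Proof.
move=> us q0 Y0; set m := (2 * q)%N => /=.
set V := \sum_(k <- s) _; set M := \sum_(k <- s) \int[P]_w Y k w ^+ m.
have m0 : 0 < m%:R :> R by rewrite ltr0n muln_gt0.
have V0 : 0 <= V by apply: sumr_ge0 => k _; apply: mean_ge0 => w; exact: sqr_ge0.
have Ym k w : 0 <= Y k w ^+ m by rewrite exprM exprn_ge0// sqr_ge0.
have M0 : 0 <= M by apply: sumr_ge0 => k _; exact: mean_ge0.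
have VM0 : 0 <= V ^+ q / m%:R ^+ q + M.
  by rewrite addr_ge0// divr_ge0// exprn_ge0// ltW.
rewrite -ler_pdivrMl ?mulr_gt0 ?expR_gt0 ?ltr0n ?fact_gt0//.
(* The slack [e] keeps [T] positive even when all the moments vanish. *)
apply/ler_addgt0Pr => e e0.
rewrite ler_pdivrMl ?mulr_gt0 ?expR_gt0 ?ltr0n ?fact_gt0//.
set W := _ + e.
have W0 : 0 < W by rewrite ltr_wpDl.
pose T := W `^ m%:R^-1.
have T0 : 0 < T by exact: powR_gt0.
have Tm : T ^+ m = W.
  by rewrite -powR_mulrn ?ltW// -powRrM mulVf ?gt_eqF// powRr1// ltW.
have VT : V <= m%:R * T ^+ 2.
  rewrite mulrC -ler_pdivrMr// -(ler_pXn2r q0) ?nnegrE ?sqr_ge0 ?divr_ge0 ?(ltW m0)//.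
  by rewrite -exprM -/m Tm expr_div_n /W -addrA lerDl addr_ge0// ltW.
have MT : M <= T ^+ m.
  have : 0 <= V ^+ q / m%:R ^+ q by rewrite divr_ge0// exprn_ge0// ltW.
  by rewrite Tm /W; lra.
rewrite (le_trans (ler_norm _))// mulrAC -Tm (_ : 4 * _ = 2 * (2 * m%:R)); last by ring.
apply: moment_sum_le => //.
case=> [//|[_|l /= lm]].
  rewrite big1 ?mulr_ge0 ?exprn_ge0 ?(ltW T0)//.
  by move=> k _; under eq_fun do rewrite expr1; rewrite Y0 normr0.
have TlE : T ^+ (m - l.+2) * T ^+ l.+2 = T ^+ m by rewrite -exprD subnK.
(* Pointwise interpolation between the orders 2 and [m]: the first term dominates when [|y| <= T],
   the second one otherwise. *)
have key (y : R) : `|y| ^+ l.+2 <= T ^+ l * y ^+ 2 + T ^+ l.+2 / T ^+ m * y ^+ m.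
  have a1 : 0 <= T ^+ l * y ^+ 2 by rewrite mulr_ge0 ?sqr_ge0 ?exprn_ge0 ?(ltW T0).
  have ym : 0 <= y ^+ m by rewrite exprM exprn_ge0// sqr_ge0.
  have a2 : 0 <= T ^+ l.+2 / T ^+ m * y ^+ m.
    by rewrite mulr_ge0// divr_ge0// exprn_ge0// ltW.
  have [yT|Ty] := leP `|y| T.
    rewrite -[leLHS]addr0; apply: lerD => //.
    rewrite -addn2 exprD real_normK ?num_real// ler_wpM2r ?sqr_ge0//.
    by rewrite lerXn2r ?nnegrE// ltW.
  rewrite -[leLHS]add0r; apply: lerD => //.
  have -> : y ^+ m = `|y| ^+ m by rewrite !exprM real_normK ?num_real.
  rewrite -TlE invfM mulrCA mulfV ?mulr1 ?expf_neq0 ?gt_eqF//.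
  rewrite mulrC ler_pdivlMr ?exprn_gt0// -{2}(subnK lm) exprD mulrC.
  by rewrite ler_wpM2r ?exprn_ge0// lerXn2r ?nnegrE ?(ltW T0) ?(ltW Ty).
apply: (@le_trans _ _ (T ^+ l * V + T ^+ l.+2 / T ^+ m * M)).
  rewrite !mulr_sumr -big_split /=; apply: ler_sum => k _.
  apply: (le_trans (norm_mean_le P (bmeasX _ (bY k)))).
  rewrite -!meanZ -?meanD; try by do ?apply: bmeasZ; exact: bmeasX.
  apply: le_mean => [|| w].
  - by apply/bmeas_norm/bmeasX.
  - by apply: bmeasD; apply: bmeasZ; exact: bmeasX.
  - by rewrite normrX; exact: key.
have m1 : 1 <= m%:R :> R by rewrite ler1n muln_gt0.
have : T ^+ l * V <= m%:R * T ^+ l.+2.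
  by rewrite -addn2 exprD mulrCA ler_wpM2l// exprn_ge0// ltW.
have : T ^+ l.+2 / T ^+ m * M <= T ^+ l.+2.
  by rewrite -mulrA ger_pMr ?exprn_gt0// ler_pdivrMl ?exprn_gt0// mulr1.
have : T ^+ l.+2 <= m%:R * T ^+ l.+2 by rewrite ler_peMl// exprn_ge0// ltW.
by lra.
Qed.

End Moments.

(** * Convexity of powers and averages over subsets *)

Section PowerMean.
Context {R : realFieldType}.

(** The left side is the tangent at [m] of the convex function [x ^+ q.+1]. Multiplying the
    inequality by [x] gives the next one up to the nonnegative term [(q+1) m^q (x - m)^2]. *)
Lemma expr_tangent (x m : R) (q : nat) : 0 <= x -> 0 <= m ->
  m ^+ q.+1 + q.+1%:R * m ^+ q * (x - m) <= x ^+ q.+1.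
Proof.
move=> x0 m0; elim: q => [|q IH]; first by rewrite !expr1 expr0; lra.
have -> : m ^+ q.+2 + q.+2%:R * m ^+ q.+1 * (x - m) =
    x * (m ^+ q.+1 + q.+1%:R * m ^+ q * (x - m)) -
    q.+1%:R * m ^+ q * (x - m) ^+ 2.
  by rewrite -(natr1 q.+1) !exprS; ring.
rewrite [leRHS]exprS lerBlDr (le_trans (ler_wpM2l x0 IH))// lerDl.
by rewrite mulr_ge0 ?sqr_ge0// mulr_ge0// exprn_ge0.
Qed.

(** Sum the tangent inequality at the mean [m] of the [u i]: the linear terms cancel. *)
Lemma power_mean (I : finType) (u : I -> R) (q : nat) : (0 < #|I|)%N ->
  (forall i, 0 <= u i) ->
  (#|I|%:R^-1 * \sum_i u i) ^+ q <= #|I|%:R^-1 * \sum_i u i ^+ q.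
Proof.
move=> I0 u0; have N0 : #|I|%:R != 0 :> R by rewrite pnatr_eq0 -lt0n.
set m := _ * _.
have m0 : 0 <= m by rewrite mulr_ge0 ?invr_ge0// sumr_ge0.
case: q => [|q].
  under eq_bigr do rewrite expr0.
  by rewrite expr0 sumr_const mulVf.
rewrite ler_pdivlMl ?ltr0n//.
apply: (@le_trans _ _ (\sum_i (m ^+ q.+1 + q.+1%:R * m ^+ q * (u i - m)))).
  have mN : m *+ #|I| = \sum_i u i by rewrite -[LHS]mulr_natl mulVKf.
  rewrite big_split /= -mulr_sumr sumrB !sumr_const mN subrr mulr0 addr0.
  by rewrite [leLHS]mulr_natl.
by apply: ler_sum => i _; exact: expr_tangent.
Qed.

Lemma exprD_le (x y : R) (q : nat) : 0 <= x -> 0 <= y ->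
  (x + y) ^+ q <= 2 ^+ q * (x ^+ q + y ^+ q).
Proof.
move=> x0 y0; wlog xy : x y x0 y0 / x <= y.
  move=> H; have [/H|/ltW yx] := leP x y; first exact.
  by rewrite addrC [_ ^+ q + _]addrC; exact: H.
apply: (@le_trans _ _ ((2 * y) ^+ q)).
  by rewrite lerXn2r ?nnegrE ?addr_ge0 ?mulr_ge0//; lra.
by rewrite exprMn ler_wpM2l ?exprn_ge0// lerDr exprn_ge0.
Qed.

(** Adding or removing [i] is an involution of the subsets that preserves [F] and flips the sign, so
    the sum is its own opposite. *)
Lemma bigsum_sign_toggle (I : finType) (i : I) (F : {set I} -> R) :
  (forall A, F (A :\ i)%SET = F (i |: A)%SET) ->
  \sum_(A : {set I}) (-1) ^+ (i \in A) * F A = 0.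
Proof.
move=> FA; pose t (A : {set I}) := if i \in A then (A :\ i)%SET else (i |: A)%SET.
have it A : (i \in t A) = (i \notin A).
  by rewrite /t; case: (boolP (i \in A)) => iA; rewrite !inE eqxx.
have tK : involutive t.
  move=> A; rewrite {1}/t it /t; case: (boolP (i \in A)) => iA /=.
    by rewrite finset.setD1K.
  by rewrite finset.setU1K.
have Ft A : F (t A) = F A.
  rewrite /t; case: ifPn => iA; first by rewrite FA (finset.setUidPr _) ?finset.sub1set.
  by rewrite -FA; congr F; apply/finset.setDidPl; rewrite disjoint_sym disjoints1.
set s := LHS; suff : s = - s by move=> /eqP; rewrite -addr_eq0 -mulr2n mulrn_eq0 =>
  /eqP.
rewrite {1}/s (reindex_inj (inv_inj tK)) /= -sumrN; apply: eq_bigr => A _.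
by rewrite it Ft; case: (i \in A); rewrite /= ?expr0 ?expr1; ring.
Qed.

(* With [s_j = 1] off [A] and [-1] on [A], the indicator of [i in A, k notin A] is
   [(1 - s_i) (1 + s_k) / 4]. *)
Lemma sum_split_pair (I : finType) (i k : I) :
  4 * \sum_(A : {set I}) ((i \in A) && (k \notin A))%:R =
  (i != k)%:R * 2 ^+ #|I| :> R.
Proof.
have [<-|ik] := eqVneq i k.
  by rewrite mul0r big1 ?mulr0// => A _; rewrite andbN.
pose s (j : I) (A : {set I}) : R := (-1) ^+ (j \in A).
have E (A : {set I}) : ((i \in A) && (k \notin A))%:R =
    4^-1 * (1 - s i A * 1 + s k A * 1 - s i A * s k A).
  by rewrite /s; case: (i \in A); case: (k \in A); rewrite /= ?expr0 ?expr1; field.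
under eq_bigr do rewrite E.
rewrite -mulr_sumr mulVKf ?pnatr_eq0//.
rewrite !(big_split, sumrN) /= !bigsum_sign_toggle//; last first.
  by move=> A; rewrite /s !inE eq_sym (negPf ik).
rewrite oppr0 !addr0 mul1r sumr_const.
by rewrite (_ : #|_| = 2 ^ #|I|)%N ?natrX// -[LHS]cardsT -finset.powersetT
  card_powerset cardsT.
Qed.

End PowerMean.

Lemma leq_fact_exp (m : nat) : (m`! <= m ^ m)%N.
Proof.
rewrite fact_prod; apply: (@leq_trans (\prod_(1 <= i < m.+1) m)).
  rewrite big_nat_cond [leqRHS]big_nat_cond.
  by apply: leq_prod => i /andP[/andP[_]].
by rewrite prod_nat_const_nat subn1.
Qed.

Definition rosenthal_cst (R : realType) (m : nat) : R := m`!%:R * expR (4 * m%:R).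

Lemma rosenthal_cst_ge0 (R : realType) m : 0 <= rosenthal_cst R m.
Proof. by rewrite mulr_ge0 ?expR_ge0. Qed.

(** * Even moments of the chaos, given positive bounds on its parameters *)

Section Chaos.
Context {R : realType} {d d' : measure_display}.
Context {Omega : measurableType d} {S : measurableType d'}.
Variables (P : probability Omega R) (n : nat).
Variables (X1 X2 : 'I_n -> {RV P >-> S}) (h : 'I_n -> 'I_n -> S * S -> R).
Hypothesis indX : mutually_independent (family12 X1 X2).
Hypothesis bh : forall i j, bmeas (h i j).
Hypothesis mean1_h : forall i j,
  {ae P, forall v, \int[P]_w h i j (X1 i w, X2 j v) = 0}.
Hypothesis mean2_h : forall i j,
  {ae P, forall w, \int[P]_v h i j (X1 i w, X2 j v) = 0}.
(** Positive upper bounds for the four parameters of the theorem; positivity keeps the scales [T] in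
    the moment inequalities positive. *)
Variables a b c D : R.
Hypotheses (a0 : 0 < a) (b0 : 0 < b) (c0 : 0 < c) (D0 : 0 < D).
Hypothesis h_le_a : forall i j z, `|h i j z| <= a.
Hypothesis h1_le_b : forall j y,
  \sum_i \int[P]_w h i j (X1 i w, y) ^+ 2 <= b ^+ 2.
Hypothesis h2_le_b : forall i x,
  \sum_j \int[P]_v h i j (x, X2 j v) ^+ 2 <= b ^+ 2.
Hypothesis h_le_c : \sum_i \sum_j
  \int[P]_w \int[P]_v h i j (X1 i w, X2 j v) ^+ 2 <= c ^+ 2.
(** Dual form of the parameter [D]: the supremum over the [f_i] has been replaced by the norm of the
    image of [g]. *)
Hypothesis h_le_D : forall (g : 'I_n -> S -> R) (t : R), 0 < t ->
  (forall j, bmeas (g j)) -> \sum_j \int[P]_v g j (X2 j v) ^+ 2 <= t ^+ 2 ->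
  \sum_i \int[P]_w
    (\sum_j \int[P]_v (h i j (X1 i w, X2 j v) * g j (X2 j v))) ^+ 2 <=
  D ^+ 2 * t ^+ 2.

Let bh1 i j y : bmeas (fun x => h i j (x, y)).
Proof. exact: bmeas_slice1. Qed.

Let bh2 i j x : bmeas (fun y => h i j (x, y)).
Proof. exact: bmeas_slice2. Qed.

Let bhX2 i j x : bmeas (fun v => h i j (x, X2 j v)).
Proof. by apply: (bmeas_comp (bh2 i j x)). Qed.

Let bhX1 i j y : bmeas (fun w => h i j (X1 i w, y)).
Proof. by apply: (bmeas_comp (bh1 i j y)). Qed.

Let bhXX i j : bmeas (fun z : Omega * Omega => h i j (X1 i z.1, X2 j z.2)).
Proof.
apply: (bmeas_comp (bh i j)); apply: measurable_fun_pair.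
- by apply: measurableT_comp.
- by apply: measurableT_comp.
Qed.

(* Kernels of the Hilbert space summands: [gram i k (x, x')] is the inner product of
   [(h_{i,j}(x, X_j^(2)))_j] and [(h_{k,j}(x', X_j^(2)))_j]. *)
Definition gram i k (z : S * S) : R :=
  \sum_j \int[P]_v (h i j (z.1, X2 j v) * h k j (z.2, X2 j v)).

(** For [I = J] this is the squared norm of the sum of the [v_i] over [J]; disjoint [I] and [J]
    serve for the off-diagonal part. *)
Definition gramsum (I J : {set 'I_n}) (w : Omega) : R :=
  \sum_(i in I) \sum_(k in J) gram i k (X1 i w, X1 k w).

Lemma bmeas_gram i k : bmeas (gram i k).
Proof.
apply: bmeas_sum => j.
apply: (@bmeas_mean2 _ _ _ _ _ _ (fun y : (S * S) * Omega =>
  h i j (y.1.1, X2 j y.2) * h k j (y.1.2, X2 j y.2))).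
apply: bmeasM; apply: (bmeas_comp (bh _ _)); apply: measurable_fun_pair;
  apply: measurableT_comp => //; exact: measurableT_comp.
Qed.

Lemma bmeas_gramX i k : bmeas (fun w => gram i k (X1 i w, X1 k w)).
Proof. by apply: (bmeas_comp (bmeas_gram i k)); apply: measurable_fun_pair. Qed.

Lemma bmeas_gramsum I J : bmeas (gramsum I J).
Proof. by do 2!apply: bmeas_sum => ?; exact: bmeas_gramX. Qed.

(** Cauchy-Schwarz, from [x y <= t / (2 s) x^2 + s / (2 t) y^2] with weights adapted to the two norm
    bounds. *)
Lemma gram_sum_le (s t : R) (f g : 'I_n -> S -> R) : 0 < s -> 0 < t ->
  (forall j, bmeas (f j)) -> (forall j, bmeas (g j)) ->
  \sum_j \int[P]_v f j (X2 j v) ^+ 2 <= s ^+ 2 ->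
  \sum_j \int[P]_v g j (X2 j v) ^+ 2 <= t ^+ 2 ->
  `|\sum_j \int[P]_v (f j (X2 j v) * g j (X2 j v))| <= s * t.
Proof.
move=> s0 t0 bf bg fs gt.
have bfX j : bmeas (fun v => f j (X2 j v)) by apply: (bmeas_comp (bf j)).
have bgX j : bmeas (fun v => g j (X2 j v)) by apply: (bmeas_comp (bg j)).
apply: (@le_trans _ _ (\sum_j \int[P]_v ((t / (2 * s)) * f j (X2 j v) ^+ 2 +
    (s / (2 * t)) * g j (X2 j v) ^+ 2))).
  rewrite (le_trans (ler_norm_sum _ _ _))//; apply: ler_sum => j _.
  rewrite (le_trans (norm_mean_le P (bmeasM (bfX j) (bgX j))))//.
  apply: le_mean => [||v].
  - exact/bmeas_norm/bmeasM.
  - by apply: bmeasD; apply: bmeasZ; exact: bmeasX.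
  rewrite normrM -(real_normK (num_real (f j _))) -(real_normK (num_real (g j _))).
  move: `|f j _| `|g j _| => x y; rewrite -subr_ge0.
  have -> : t / (2 * s) * x ^+ 2 + s / (2 * t) * y ^+ 2 - x * y =
      (t * x - s * y) ^+ 2 / (2 * (s * t)).
    by field; rewrite (gt_eqF s0) (gt_eqF t0).
  by rewrite divr_ge0 ?sqr_ge0// mulr_ge0// mulr_ge0 ?ltW.
under eq_bigr => j _.
  rewrite meanD; [|by apply: bmeasZ; exact: bmeasX|by apply: bmeasZ; exact: bmeasX].
  rewrite !meanZ; [|exact: bmeasX|exact: bmeasX].
  over.
rewrite big_split /= -!mulr_sumr.
have H1 := ler_wpM2l (ltW (divr_gt0 t0 (mulr_gt0 (ltr0Sn R 1) s0))) fs.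
have H2 := ler_wpM2l (ltW (divr_gt0 s0 (mulr_gt0 (ltr0Sn R 1) t0))) gt.
rewrite (le_trans (lerD H1 H2))// le_eqVlt; apply/orP; left; apply/eqP.
by field; rewrite (gt_eqF s0) (gt_eqF t0).
Qed.

Lemma gramsumE J w : gramsum J J w =
  \sum_j \int[P]_v (\sum_(i in J) h i j (X1 i w, X2 j v)) ^+ 2.
Proof.
transitivity (\sum_j \sum_(i in J) \sum_(k in J)
    \int[P]_v (h i j (X1 i w, X2 j v) * h k j (X1 k w, X2 j v))).
  rewrite exchange_big /=; apply: eq_bigr => i _.
  by rewrite exchange_big /=.
apply: eq_bigr => j _.
under [X in _ = Rintegral _ _ X]eq_fun => v.
  rewrite expr2 mulr_suml; under eq_bigr do rewrite mulr_sumr; over.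
rewrite mean_sum; last by move=> i; apply: bmeas_sum => k; exact: bmeasM.
by apply: eq_bigr => i _; rewrite mean_sum// => k; exact: bmeasM.
Qed.

Lemma gramsum_ge0 J w : 0 <= gramsum J J w.
Proof.
by rewrite gramsumE; apply: sumr_ge0 => j _; apply: mean_ge0 => v; exact: sqr_ge0.
Qed.

Lemma gram_diag_ge0 i x : 0 <= gram i i (x, x).
Proof.
by apply: sumr_ge0 => j _; apply: mean_ge0 => v; rewrite -expr2; exact: sqr_ge0.
Qed.

Lemma gram_diag_le i x : gram i i (x, x) <= b ^+ 2.
Proof. exact: h2_le_b. Qed.

Lemma mean_gram_diag : \sum_i \int[P]_w gram i i (X1 i w, X1 i w) <= c ^+ 2.
Proof.
rewrite (le_trans _ h_le_c)//; apply: ler_sum => i _.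
rewrite mean_sum//= => j.
apply: (@bmeas_mean2 _ _ _ _ _ _ (fun z : Omega * Omega =>
  h i j (X1 i z.1, X2 j z.2) * h i j (X1 i z.1, X2 j z.2))).
exact: bmeasM.
Qed.

(** By Fubini the mean over [w] is taken first, and it vanishes for almost every [v] by degeneracy.
    The null set concerns [v] only, so [x] may be any fixed point. *)
Lemma mean_gram0 i k x : \int[P]_w gram i k (X1 i w, x) = 0.
Proof.
have bF j : bmeas (fun z : Omega * Omega =>
    h i j (X1 i z.1, X2 j z.2) * h k j (x, X2 j z.2)).
  apply: bmeasM => //; apply: (bmeas_comp (bhX2 k j x)).
  exact: measurable_snd.
rewrite mean_sum; last by move=> j; exact: (bmeas_mean2 P (bF j)).
apply: big1 => j _; rewrite (mean_swap P P (bF j)) /=.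
rewrite -[RHS](mean_cst P); apply: ae_eq_mean.
- exact: (bmeas_mean1 P (bF j)).
- exact: bmeas_cst.
- by apply: filterS (mean1_h i j) => v hv; rewrite meanZr// hv mul0r.
Qed.

(** * Moments of Gram sums: off-diagonal part, diagonal part and their recombination *)

Definition partial_gram (J : {set 'I_n}) (w : Omega) (i : 'I_n) (x : S) : R :=
  \sum_(k in J) gram i k (x, X1 k w).

(** Coordinates of the vector [sum_{k in J} v_k] frozen at [w]; [partial_gram] is its inner product
    with the vector of index [i] at [x]. *)
Definition partial_kernel (J : {set 'I_n}) (w : Omega) (j : 'I_n) (y : S) : R :=
  \sum_(k in J) h k j (X1 k w, y).

Let bmeas_partial_kernel J w j : bmeas (partial_kernel J w j).
Proof. exact: bmeas_sum. Qed.

Let partial_gramE J w i x : partial_gram J w i x =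
  \sum_j \int[P]_v (h i j (x, X2 j v) * partial_kernel J w j (X2 j v)).
Proof.
rewrite /partial_gram exchange_big /=; apply: eq_bigr => j _.
rewrite /partial_kernel; under [X in _ = Rintegral _ _ X]eq_fun do rewrite mulr_sumr.
by rewrite mean_sum// => k; exact: bmeasM.
Qed.

Let bmeas_partial_gram J w i : bmeas (partial_gram J w i).
Proof. by apply: bmeas_sum => k; exact: bmeas_slice1 (bmeas_gram i k). Qed.

(** With the second factor frozen and of norm at most [t], the summands are independent, centred,
    bounded by [b t], with total variance at most [D^2 t^2]. Bernstein's inequality applies with
    [T = t (D / sqrt q + b)], since [T >= b t] and [q T^2 >= D^2 t^2]. *)
Lemma cross_moment_fixed (I J : {set 'I_n}) (w : Omega) (r : nat) : (0 < r)%N ->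
  let q := (2 * r)%N in
  \int[P]_v (\sum_(i in I) partial_gram J w i (X1 i v)) ^+ q <=
  q`!%:R * expR (2 * q%:R) * (D / Num.sqrt q%:R + b) ^+ q *
  (gramsum J J w + c ^+ 2) ^+ r.
Proof.
move=> r0; set q := (2 * r)%N => /=.
have q0 : 0 < q%:R :> R by rewrite ltr0n muln_gt0.
set s := Num.sqrt _; have s0 : 0 < s by rewrite sqrtr_gt0.
have sq : s ^+ 2 = q%:R by rewrite sqr_sqrtr// ltW.
(* The added [c ^+ 2] makes the norm bound [t] positive whatever [w] is. *)
set V := gramsum J J w + c ^+ 2.
have V0 : 0 < V by rewrite ltr_wpDl ?gramsum_ge0// exprn_gt0.
set t := Num.sqrt V; have t0 : 0 < t by rewrite sqrtr_gt0.
have tV : t ^+ 2 = V by rewrite sqr_sqrtr// ltW.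
have gt : \sum_j \int[P]_v partial_kernel J w j (X2 j v) ^+ 2 <= t ^+ 2.
  by rewrite tV /V gramsumE lerDl sqr_ge0.
pose T := t * (D / s + b).
have Ds0 : 0 < D / s by rewrite divr_gt0.
have T0 : 0 < T by rewrite mulr_gt0// addr_gt0.
(* Independence is stated for the joint family, so the summands are extended by 0 to the second
   group of variables. *)
pose phi (k : 'I_n + 'I_n) (x : S) : R := if k is inl i then partial_gram J w i x
  else 0.
have bphi k : bmeas (phi k) by case: k => i; [exact: bmeas_partial_gram|exact:
  (bmeas_cst 0)].
pose e : seq ('I_n + 'I_n) := [seq inl i | i <- enum I].
have ue : uniq e by rewrite map_inj_uniq ?enum_uniq// => i j [].
have sumE (F : 'I_n + 'I_n -> R) : \sum_(k <- e) F k = \sum_(i in I) F (inl i).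
  by rewrite big_map big_enum.
have -> : \int[P]_v (\sum_(i in I) partial_gram J w i (X1 i v)) ^+ q =
    \int[P]_v (\sum_(k <- e) phi k (family12 X1 X2 k v)) ^+ q.
  by apply: eq_Rintegral => v _; rewrite sumE.
have -> : q`!%:R * expR (2 * q%:R) * (D / s + b) ^+ q * V ^+ r =
    q`!%:R * T ^+ q * expR (2 * q%:R).
  by rewrite /T exprMn [t ^+ q]exprM tV; ring.
apply: (le_trans (ler_norm _)); apply: (bernstein_moment indX bphi) => //.
- case=> i /=; last by rewrite mean_cst.
  rewrite /partial_gram mean_sum; first by apply: big1 => k _; exact: mean_gram0.
  move=> k; apply: (bmeas_comp (bmeas_slice1 (X1 k w) (bmeas_gram i k))).
  by [].
- case=> i v /=; last by rewrite normr0 ltW.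
  rewrite partial_gramE (le_trans (gram_sum_le (f := fun j y => h i j (X1 i v, y))
    b0 t0 _ (bmeas_partial_kernel J w) (h2_le_b i (X1 i v)) gt))//.
  by rewrite mulrC /T ler_wpM2l ?(ltW t0)// lerDr ltW.
- rewrite sumE /=; have H := h_le_D t0 (bmeas_partial_kernel J w) gt.
  apply: (@le_trans _ _ (D ^+ 2 * t ^+ 2)).
    rewrite (le_trans _ H)//; under eq_bigr => i _.
      under eq_fun do rewrite partial_gramE.
      over.
    rewrite [leRHS](bigID (mem I)) /= lerDl; apply: sumr_ge0 => i _.
    by apply: mean_ge0 => v; exact: sqr_ge0.
  have -> : q%:R * T ^+ 2 = t ^+ 2 * (D + s * b) ^+ 2.
    rewrite /T -sq (_ : D + s * b = s * (D / s + b)); last first.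
      by rewrite mulrDr mulrCA divff ?mulr1// gt_eqF.
    by rewrite !exprMn; ring.
  rewrite [leLHS]mulrC ler_wpM2l ?sqr_ge0// lerXn2r ?nnegrE ?(ltW D0)//.
    by rewrite addr_ge0 ?mulr_ge0 ?ltW.
  by rewrite lerDl mulr_ge0// ltW.
Qed.

(** As [I] and [J] are disjoint, decoupling freezes the variables of [J] at [w] and reads those of
    [I] at [v]; the bound for fixed [w] is then integrated. *)
Lemma cross_moment (I J : {set 'I_n}) (r : nat) :
  {in I, forall i, i \notin J} -> (0 < r)%N ->
  let q := (2 * r)%N in
  \int[P]_w (gramsum I J w) ^+ q <=
  q`!%:R * expR (2 * q%:R) * (D / Num.sqrt q%:R + b) ^+ q *
  \int[P]_w (gramsum J J w + c ^+ 2) ^+ r.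
Proof.
move=> IJ r0; set q := (2 * r)%N => /=.
pose K := ('I_n + 'I_n)%type.
pose F (x : vect K S) : R :=
  (\sum_(i in I) \sum_(k in J) gram i k (x (inl i), x (inl k))) ^+ q.
have bF : bmeas F.
  apply: bmeasX; do 2!apply: bmeas_sum => ?.
  apply: (bmeas_comp (bmeas_gram _ _)).
  by apply: measurable_fun_pair; exact: measurable_coord.
have bG : bmeas (fun w => (gramsum J J w + c ^+ 2) ^+ r).
  by apply/bmeasX/bmeasD; [exact: bmeas_gramsum|exact: bmeas_cst].
rewrite -meanZ//.
have -> : \int[P]_w gramsum I J w ^+ q =
    \int[P]_w \int[P]_v (\sum_(i in I) partial_gram J w i (X1 i v)) ^+ q.
  rewrite [LHS](decouple indX [set inl k | k in J]%SET bF) /F /=.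
  apply: eq_Rintegral => w _; apply: eq_Rintegral => v _; congr (_ ^+ _).
  apply: eq_bigr => i iI; apply: eq_bigr => k kJ.
  rewrite !(mem_imset _ _ (@inl_inj _ _)) kJ.
  by rewrite (negPf (IJ i iI)).
apply: le_mean.
- apply: (@bmeas_mean2 _ _ _ _ _ _ (fun z : Omega * Omega =>
    (\sum_(i in I) partial_gram J z.1 i (X1 i z.2)) ^+ q)).
  apply: bmeasX; do 2!apply: bmeas_sum => ?.
  apply: (bmeas_comp (bmeas_gram _ _)).
  by apply: measurable_fun_pair; apply: measurableT_comp.
- exact: bmeasZ.
- by move=> w; exact: cross_moment_fixed.
Qed.

(** The diagonal terms are nonnegative, at most [b^2], with total mean at most [c^2]. With
    [T = c^2 / q + b^2] their moments of order [l+1] sum to at most [T^l c^2 <= q T^(l+1)], which is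
    [beta = q]. *)
Lemma diag_moment (J : {set 'I_n}) (q : nat) : (0 < q)%N ->
  \int[P]_w (\sum_(i in J) gram i i (X1 i w, X1 i w)) ^+ q <=
  q`!%:R * expR (2 * q%:R) * (c ^+ 2 / q%:R + b ^+ 2) ^+ q.
Proof.
move=> q0; set T := c ^+ 2 / q%:R + b ^+ 2.
have qR0 : 0 < q%:R :> R by rewrite ltr0n.
have T0 : 0 < T by rewrite addr_gt0// ?divr_gt0// exprn_gt0.
pose phi (k : 'I_n + 'I_n) (x : S) : R := if k is inl i then gram i i (x, x) else 0.
have bphi k : bmeas (phi k).
  case: k => i; last exact: (bmeas_cst 0).
  by apply: (bmeas_comp (bmeas_gram i i)); exact: measurable_fun_pair.
pose e : seq ('I_n + 'I_n) := [seq inl i | i <- enum J].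
have ue : uniq e by rewrite map_inj_uniq ?enum_uniq// => i j [].
have sumE (F : 'I_n + 'I_n -> R) : \sum_(k <- e) F k = \sum_(i in J) F (inl i).
  by rewrite big_map big_enum.
rewrite [leRHS](_ : _ = q`!%:R * T ^+ q * expR (2 * q%:R)); last by ring.
have -> : \int[P]_w (\sum_(i in J) gram i i (X1 i w, X1 i w)) ^+ q =
    \int[P]_v (\sum_(k <- e) phi k (family12 X1 X2 k v)) ^+ q.
  by apply: eq_Rintegral => v _; rewrite sumE.
apply: (le_trans (ler_norm _)); apply: (moment_sum_le indX bphi) => //.
case=> [//|l _]; rewrite sumE /=.
apply: (@le_trans _ _ (T ^+ l * c ^+ 2)); last first.
  have -> : q%:R * T ^+ l.+1 = T ^+ l * (q%:R * T) by rewrite exprSr; ring.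
  rewrite ler_wpM2l ?exprn_ge0 ?(ltW T0)// /T mulrDr mulrCA divff ?gt_eqF// mulr1.
  by rewrite lerDl mulr_ge0 ?sqr_ge0// ltW.
apply: (@le_trans _ _ (\sum_(i in J) T ^+ l * \int[P]_w gram i i (X1 i w, X1 i w))).
  apply: ler_sum => i _.
  have bi := bmeas_gramX i i.
  rewrite -meanZ// (le_trans (norm_mean_le P (bmeasX _ bi)))//.
  apply: le_mean => [||w].
  - exact/bmeas_norm/bmeasX.
  - exact: bmeasZ.
  have g0 := gram_diag_ge0 i (X1 i w).
  rewrite ger0_norm ?exprn_ge0// exprSr ler_wpM2r// lerXn2r ?nnegrE ?(ltW T0)//.
  by rewrite (le_trans (gram_diag_le _ _))// /T lerDr divr_ge0 ?sqr_ge0.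
rewrite -mulr_sumr ler_wpM2l ?exprn_ge0 ?(ltW T0)//.
rewrite (le_trans _ mean_gram_diag)// [leRHS](bigID (mem J)) /= lerDl.
by apply: sumr_ge0 => i _; apply: mean_ge0 => w; exact: gram_diag_ge0.
Qed.

(** A uniformly random subset [A] contains [i] but not [k] with probability 1/4 if [i] and [k]
    differ, and never if they coincide; hence the factor 4. *)
Lemma gramsum_split (J : {set 'I_n}) w :
  gramsum J J w = \sum_(i in J) gram i i (X1 i w, X1 i w) +
    4 * (#|{set 'I_n}|%:R^-1 *
         \sum_(A : {set 'I_n}) gramsum (J :&: A)%SET (J :\: A)%SET w).
Proof.
pose N : R := #|{set 'I_n}|%:R.
have NE : N = 2 ^+ #|'I_n|.
  by rewrite /N -cardsT -finset.powersetT card_powerset cardsT natrX.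
have N0 : N != 0 by rewrite NE expf_neq0// pnatr_eq0.
have WE (A : {set 'I_n}) : gramsum (J :&: A)%SET (J :\: A)%SET w =
    \sum_(i in J) \sum_(k in J)
      ((i \in A) && (k \notin A))%:R * gram i k (X1 i w, X1 k w).
  rewrite /gramsum big_mkcond [RHS]big_mkcond /=; apply: eq_bigr => i _.
  rewrite !inE; case: (i \in J) => //=.
  case: (boolP (i \in A)) => iA /=; last first.
    by rewrite big1// => k _; rewrite mul0r.
  rewrite big_mkcond [RHS]big_mkcond /=; apply: eq_bigr => k _.
  by rewrite !inE andbC; case: (k \in J) => //=; case: (k \in A); rewrite /= ?mul0r
    ?mul1r.
have -> : 4 * (N^-1 * \sum_(A : {set 'I_n}) gramsum (J :&: A)%SET (J :\: A)%SET w) =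
    \sum_(i in J) \sum_(k in J) (i != k)%:R * gram i k (X1 i w, X1 k w).
  under eq_bigr do rewrite WE.
  rewrite exchange_big /= mulrCA !mulr_sumr; apply: eq_bigr => i _.
  rewrite exchange_big /= !mulr_sumr; apply: eq_bigr => k _.
  rewrite -mulr_suml mulrA mulrA -[N^-1 * 4 * _]mulrA sum_split_pair -NE.
  by rewrite mulrCA mulVf// mulr1.
rewrite -big_split /=; apply: eq_bigr => i iJ.
rewrite (bigD1 i)//= [in RHS](bigD1 i)//= eqxx mul0r add0r; congr (_ + _).
by apply: eq_bigr => k /andP[_]; rewrite eq_sym => ->; rewrite mul1r.
Qed.

(** For the index set with the largest moment [Phi], the off-diagonal part is controlled by a moment
    of half the order over a smaller set, hence by the square root of [Phi]; half of [Phi] is then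
    absorbed on the left. *)
Lemma gramsum_moment (J : {set 'I_n}) (r : nat) : (0 < r)%N ->
  let q := (2 * r)%N in
  let R_ := Num.sqrt q%:R * D + q%:R * b in
  \int[P]_w (gramsum J J w + c ^+ 2) ^+ q <=
  2 * 4 ^+ q * ((c ^+ 2) ^+ q + expR 2 ^+ q * (c ^+ 2 + q%:R * b ^+ 2) ^+ q) +
  ((8 * expR 2 * R_) ^+ q) ^+ 2.
Proof.
move=> r0; set q := (2 * r)%N => /=.
have q0 : (0 < q)%N by rewrite muln_gt0.
have qR0 : 0 < q%:R :> R by rewrite ltr0n.
set s := Num.sqrt q%:R; have s0 : 0 < s by rewrite sqrtr_gt0.
have sq : s ^+ 2 = q%:R by rewrite sqr_sqrtr// ltW.
set R_ := s * D + q%:R * b.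
have R0 : 0 < R_ by rewrite addr_gt0// mulr_gt0.
pose Phi (J : {set 'I_n}) := \int[P]_w (gramsum J J w + c ^+ 2) ^+ q.
rewrite -/(Phi J).
have [Jm _ Jmax] := @arg_maxP _ _ _ finset.set0 xpredT Phi isT.
rewrite (le_trans (Jmax J isT))//= {J}.
pose N : R := #|{set 'I_n}|%:R.
have N0 : 0 < N by rewrite ltr0n; apply/card_gt0P; exists finset.set0.
pose W (A : {set 'I_n}) w := gramsum (Jm :&: A)%SET (Jm :\: A)%SET w.
have bW A : bmeas (W A) by exact: bmeas_gramsum.
pose Dg w := \sum_(i in Jm) gram i i (X1 i w, X1 i w).
have bD : bmeas Dg by apply: bmeas_sum => i; exact: bmeas_gramX.
have Dg0 w : 0 <= Dg w by apply: sumr_ge0 => i _; exact: gram_diag_ge0.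
have bV J : bmeas (fun w => gramsum J J w + c ^+ 2).
  by apply: bmeasD; [exact: bmeas_gramsum|exact: bmeas_cst].
have V0 J w : 0 <= gramsum J J w + c ^+ 2 by rewrite addr_ge0 ?gramsum_ge0 ?sqr_ge0.
have evenq (x : R) : `|x| ^+ q = x ^+ q by rewrite !exprM real_normK ?num_real.
(* Splitting the sum in two twice costs [2 ^+ q] each time; the factor 4 of the off-diagonal average
   turns [2 ^+ q] into [8 ^+ q]. *)
have pointwise w : (gramsum Jm Jm w + c ^+ 2) ^+ q <=
    4 ^+ q * ((c ^+ 2) ^+ q + Dg w ^+ q) + 8 ^+ q * (N^-1 * \sum_A W A w ^+ q).
  pose A' := N^-1 * \sum_A `|W A w|.
  have A0 : 0 <= A' by rewrite mulr_ge0 ?sumr_ge0// invr_ge0 ltW.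
  have A'q : A' ^+ q <= N^-1 * \sum_A W A w ^+ q.
    under eq_bigr do rewrite -evenq.
    by apply: power_mean => //; apply/card_gt0P; exists finset.set0.
  apply: (@le_trans _ _ (((c ^+ 2 + Dg w) + 4 * A') ^+ q)).
    rewrite lerXn2r ?nnegrE ?V0//.
      by rewrite !addr_ge0 ?sqr_ge0 ?Dg0// mulr_ge0.
    rewrite gramsum_split addrC -!addrA lerD2l lerD2l ler_wpM2l// ler_wpM2l ?invr_ge0
      ?(ltW N0)//.
    by apply: ler_sum => A _; exact: ler_norm.
  have D2 := exprD_le q (sqr_ge0 c) (Dg0 w).
  have := exprD_le q (addr_ge0 (sqr_ge0 c) (Dg0 w)) (mulr_ge0 (ler0n _ 4) A0).
  move=> /le_trans; apply; rewrite exprMn.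
  have -> : 4 ^+ q = 2 ^+ q * 2 ^+ q :> R by rewrite -exprMn; congr (_ ^+ _); ring.
  have -> : 8 ^+ q = 2 ^+ q * (2 ^+ q * 2 ^+ q) :> R.
    by rewrite -!exprMn; congr (_ ^+ _); ring.
  rewrite -!mulrA -mulrDr ler_wpM2l ?exprn_ge0// lerD//.
  by rewrite !ler_wpM2l ?exprn_ge0.
have crossW A : 8 ^+ q * \int[P]_w W A w ^+ q <=
    2^-1 * Phi Jm + 2^-1 * ((8 * expR 2 * R_) ^+ q) ^+ 2.
  have dIJ : {in (Jm :&: A)%SET, forall i, i \notin (Jm :\: A)%SET}.
    by move=> i; rewrite !inE => /andP[_ ->].
  have := cross_moment dIJ r0; rewrite -/q /= -/s => H.
  set Y := fun w => gramsum (Jm :\: A)%SET (Jm :\: A)%SET w + c ^+ 2.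
  (* [q! <= q^q] supplies the factor [q] in [R_ = q (D / s + b)]. *)
  have C1 : q`!%:R * expR (2 * q%:R) * (D / s + b) ^+ q <= (expR 2 * R_) ^+ q.
    rewrite expRM_natr exprMn mulrAC [leRHS]mulrC ler_wpM2r ?exprn_ge0 ?expR_ge0//.
    have -> : R_ = q%:R * (D / s + b).
      by rewrite /R_ mulrDr -sq; field; rewrite gt_eqF.
    rewrite exprMn ler_wpM2r ?exprn_ge0 ?addr_ge0 ?divr_ge0 ?(ltW s0) ?(ltW b0) ?(ltW
      D0)//.
    by rewrite -natrX ler_nat leq_fact_exp.
  have bY : bmeas Y by exact: bV.
  have H2 : 8 ^+ q * \int[P]_w W A w ^+ q <=
      (8 * expR 2 * R_) ^+ q * \int[P]_w Y w ^+ r.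
    rewrite -mulrA [(8 * _) ^+ q]exprMn -mulrA ler_wpM2l ?exprn_ge0//.
    rewrite (le_trans H)// ler_wpM2r//; apply: mean_ge0 => w.
    by rewrite exprn_ge0// V0.
  rewrite (le_trans H2)//; set B := (8 * expR 2 * R_) ^+ q.
  (* Arithmetic-geometric mean [B y <= y^2 / 2 + B^2 / 2] with [y = Y^r]; since [q = 2 r], the
     square is [Y^q], whose mean is at most the maximal moment. *)
  apply: (@le_trans _ _ (\int[P]_w (2^-1 * Y w ^+ q + 2^-1 * B ^+ 2))).
    rewrite -meanZ; last exact: bmeasX.
    apply: le_mean => [||w].
    - by apply: bmeasZ; exact: bmeasX.
    - by apply: bmeasD; [apply: bmeasZ; exact: bmeasX|exact: bmeas_cst].
    have -> : Y w ^+ q = (Y w ^+ r) ^+ 2 by rewrite -exprM mulnC.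
    by move: (Y w ^+ r) => y; rewrite -subr_ge0; have := sqr_ge0 (y - B); lra.
  rewrite meanD; [|by apply: bmeasZ; exact: bmeasX|exact: bmeas_cst].
  rewrite mean_cst meanZ; last exact: bmeasX.
  by rewrite lerD2r ler_wpM2l ?invr_ge0//; exact: Jmax.
have Dgq : \int[P]_w Dg w ^+ q <= expR 2 ^+ q * (c ^+ 2 + q%:R * b ^+ 2) ^+ q.
  rewrite (le_trans (diag_moment Jm q0))// expRM_natr mulrAC [leRHS]mulrC.
  rewrite ler_wpM2r ?exprn_ge0 ?expR_ge0//.
  have -> : c ^+ 2 + q%:R * b ^+ 2 = q%:R * (c ^+ 2 / q%:R + b ^+ 2).
    by field; rewrite gt_eqF.
  rewrite exprMn ler_wpM2r ?exprn_ge0 ?addr_ge0 ?divr_ge0 ?sqr_ge0//.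
  by rewrite -natrX ler_nat leq_fact_exp.
have bWq : bmeas (fun w => \sum_A W A w ^+ q).
  by apply: bmeas_sum => A; exact: bmeasX.
have main : Phi Jm <= 4 ^+ q * ((c ^+ 2) ^+ q + \int[P]_w Dg w ^+ q) +
    N^-1 * \sum_A 8 ^+ q * \int[P]_w W A w ^+ q.
  have b1 : bmeas (fun w => (c ^+ 2) ^+ q + Dg w ^+ q).
    by apply: bmeasD; [exact: bmeas_cst|exact: bmeasX].
  apply: (le_trans (le_mean P (bmeasX q (bV Jm)) _ pointwise)).
    by apply: bmeasD; do ?apply: bmeasZ.
  rewrite meanD; [|exact: bmeasZ|by do 2!apply: bmeasZ].
  rewrite !meanZ//; last exact: bmeasZ.
  rewrite meanD; [|exact: bmeas_cst|exact: bmeasX].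
  rewrite mean_cst mean_sum; last by move=> A; exact: bmeasX.
  by rewrite -mulr_sumr mulrCA.
have avg : N^-1 * \sum_A 8 ^+ q * \int[P]_w W A w ^+ q <=
    2^-1 * Phi Jm + 2^-1 * ((8 * expR 2 * R_) ^+ q) ^+ 2.
  rewrite ler_pdivrMl//; apply: (le_trans (ler_sum _ (fun A _ => crossW A))).
  by rewrite sumr_const -[leLHS]mulr_natl.
have H4 := ler_wpM2l (exprn_ge0 q (ler0n R 4)) (lerD (lexx ((c ^+ 2) ^+ q)) Dgq).
(* Moving [Phi Jm / 2] to the left doubles the remaining terms, whence the leading 2. *)
by have := le_trans main (lerD H4 avg); lra.
Qed.

(** * Conditional Rosenthal inequalities for the chaos *)

Let rosenthal1 (f : 'I_n -> S -> R) (q : nat) : (0 < q)%N ->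
  (forall i, bmeas (f i)) -> (forall i, \int[P]_w f i (X1 i w) = 0) ->
  \int[P]_w (\sum_i f i (X1 i w)) ^+ (2 * q) <=
  (2 * q)`!%:R * expR (4 * (2 * q)%:R) *
  ((\sum_i \int[P]_w f i (X1 i w) ^+ 2) ^+ q / (2 * q)%:R ^+ q +
   \sum_i \int[P]_w f i (X1 i w) ^+ (2 * q)).
Proof.
move=> q0 bf f0.
pose phi (k : 'I_n + 'I_n) (x : S) : R := if k is inl i then f i x else 0.
have bphi k : bmeas (phi k) by case: k => i; [exact: bf|exact: (bmeas_cst 0)].
pose e : seq ('I_n + 'I_n) := [seq inl i | i <- enum 'I_n].
have ue : uniq e by rewrite map_inj_uniq ?enum_uniq// => i j [].
have sumE (F : 'I_n + 'I_n -> R) : \sum_(k <- e) F k = \sum_i F (inl i).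
  by rewrite big_map big_enum.
have phi0 k : \int[P]_w phi k (family12 X1 X2 k w) = 0.
  by case: k => i /=; [exact: f0|exact: mean_cst].
have /= := rosenthal_moment indX bphi ue q0 phi0; rewrite !sumE.
by apply: le_trans; rewrite le_eqVlt; apply/orP; left; apply/eqP;
  apply: eq_Rintegral => w _; rewrite sumE.
Qed.

Let rosenthal2 (f : 'I_n -> S -> R) (q : nat) : (0 < q)%N ->
  (forall j, bmeas (f j)) -> (forall j, \int[P]_v f j (X2 j v) = 0) ->
  \int[P]_v (\sum_j f j (X2 j v)) ^+ (2 * q) <=
  (2 * q)`!%:R * expR (4 * (2 * q)%:R) *
  ((\sum_j \int[P]_v f j (X2 j v) ^+ 2) ^+ q / (2 * q)%:R ^+ q +
   \sum_j \int[P]_v f j (X2 j v) ^+ (2 * q)).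
Proof.
move=> q0 bf f0.
pose phi (k : 'I_n + 'I_n) (x : S) : R := if k is inr j then f j x else 0.
have bphi k : bmeas (phi k) by case: k => i; [exact: (bmeas_cst 0)|exact: bf].
pose e : seq ('I_n + 'I_n) := [seq inr i | i <- enum 'I_n].
have ue : uniq e by rewrite map_inj_uniq ?enum_uniq// => i j [].
have sumE (F : 'I_n + 'I_n -> R) : \sum_(k <- e) F k = \sum_i F (inr i).
  by rewrite big_map big_enum.
have phi0 k : \int[P]_w phi k (family12 X1 X2 k w) = 0.
  by case: k => i /=; [exact: mean_cst|exact: f0].
have /= := rosenthal_moment indX bphi ue q0 phi0; rewrite !sumE.
by apply: le_trans; rewrite le_eqVlt; apply/orP; left; apply/eqP;
  apply: eq_Rintegral => w _; rewrite sumE.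
Qed.

(** The two groups of variables are read at different sample points, so that each can be integrated
    with the other held fixed. *)
Definition column_sum (z : Omega * Omega) j : R := \sum_i h i j (X1 i z.1, X2 j z.2).

Let bmeas_column_sum j : bmeas (fun z => column_sum z j).
Proof. exact: bmeas_sum. Qed.

(** Rosenthal in the first variables for almost every [v]. All but one factor of the variance are
    bounded by [b^2], and all but one factor [h^2] of [h^m] by [a^2]; what is left sums to at most
    [c^2]. *)
Lemma column_moment (q : nat) : (0 < q)%N -> let m := (2 * q)%N in
  \sum_j \int[P]_w \int[P]_v column_sum (w, v) j ^+ m <=
  rosenthal_cst R m * ((b ^+ 2) ^+ q.-1 / m%:R ^+ q + (a ^+ 2) ^+ q.-1) * c ^+ 2.
Proof.
move=> q0; set m := (2 * q)%N => /=.
have m0 : 0 < m%:R :> R by rewrite ltr0n muln_gt0.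
set B := _ + _.
have B0 : 0 <= B by rewrite addr_ge0 ?divr_ge0 ?exprn_ge0 ?sqr_ge0// ltW.
apply: (@le_trans _ _ (rosenthal_cst R m * B * \sum_j \int[P]_v \sum_i
    \int[P]_w h i j (X1 i w, X2 j v) ^+ 2)); last first.
  rewrite ler_wpM2l ?mulr_ge0 ?rosenthal_cst_ge0//= (le_trans _ h_le_c)//
    exchange_big /=.
  apply: ler_sum => j _; rewrite mean_sum; last first.
    move=> i; apply: (@bmeas_mean1 _ _ _ _ _ _ (fun z : Omega * Omega =>
      h i j (X1 i z.1, X2 j z.2) ^+ 2)).
    exact: bmeasX.
  apply: ler_sum => i _.
  rewrite (mean_swap P P (F := fun z => h i j (X1 i z.1, X2 j z.2) ^+ 2))//.
  exact: bmeasX.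
rewrite mulr_sumr; apply: ler_sum => j _.
have bS : bmeas (fun v => \sum_i \int[P]_w h i j (X1 i w, X2 j v) ^+ 2).
  apply: bmeas_sum => i; apply: (@bmeas_mean1 _ _ _ _ _ _ (fun z : Omega * Omega =>
      h i j (X1 i z.1, X2 j z.2) ^+ 2)).
  exact: bmeasX.
have bUm := bmeasX m (bmeas_column_sum j).
rewrite (mean_swap P P bUm) -meanZ//; apply: ae_le_mean.
- exact: (bmeas_mean1 P bUm).
- exact: bmeasZ.
have : {ae P, forall v, forall i, \int[P]_w h i j (X1 i w, X2 j v) = 0}.
  by apply: filter_forall => i; exact: mean1_h.
apply: filterS => v hv.
have := rosenthal1 (f := fun i x => h i j (x, X2 j v)) q0 (fun i => bh1 i j _) hv.
rewrite -/m -/(rosenthal_cst R m) => /le_trans; apply.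
rewrite -mulrA ler_wpM2l ?rosenthal_cst_ge0//.
set V := \sum_i \int[P]_w _ ^+ 2.
have V0 : 0 <= V by apply: sumr_ge0 => i _; apply: mean_ge0 => w; exact: sqr_ge0.
rewrite /B mulrDl lerD//.
  rewrite mulrAC ler_wpM2r ?invr_ge0 ?exprn_ge0 ?(ltW m0)//.
  rewrite -{1}(prednK q0) exprSr ler_wpM2r// lerXn2r ?nnegrE ?sqr_ge0//.
  exact: h1_le_b.
rewrite /V mulr_sumr; apply: ler_sum => i _.
rewrite -meanZ; last exact: bmeasX.
apply: le_mean => [||w].
- exact: bmeasX.
- by apply: bmeasZ; exact: bmeasX.
rewrite /m exprM -{1}(prednK q0) exprSr ler_wpM2r ?sqr_ge0//.
rewrite lerXn2r ?nnegrE ?sqr_ge0// -[leLHS]real_normK ?num_real//.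
by rewrite lerXn2r ?nnegrE// ltW.
Qed.

(** Decouple the two groups and apply Rosenthal in the second one for almost every [w]: the
    conditional variance is the full Gram sum, and the remaining moments are those of the column
    sums. *)
Lemma Ustat_moment (q : nat) : (0 < q)%N -> let m := (2 * q)%N in
  \int[P]_w Ustat X1 X2 h w ^+ m <=
  rosenthal_cst R m * ((\int[P]_w gramsum [set: 'I_n]%SET [set: 'I_n]%SET w ^+ q) /
    m%:R ^+ q +
  rosenthal_cst R m * ((b ^+ 2) ^+ q.-1 / m%:R ^+ q + (a ^+ 2) ^+ q.-1) * c ^+ 2).
Proof.
move=> q0; have CM := column_moment q0; move: CM; set m := (2 * q)%N => /= CM.
pose K := ('I_n + 'I_n)%type.
pose F (x : vect K S) : R :=
  (\sum_i \sum_j h i j (x (inl i), x (inr j))) ^+ m.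
have bF : bmeas F.
  apply: bmeasX; do 2!apply: bmeas_sum => ?.
  apply: (bmeas_comp (bh _ _)).
  by apply: measurable_fun_pair; exact: measurable_coord.
have bUU : bmeas (fun z => (\sum_j column_sum z j) ^+ m).
  by apply: bmeasX; exact: bmeas_sum.
have -> : \int[P]_w Ustat X1 X2 h w ^+ m =
    \int[P]_w \int[P]_v (\sum_j column_sum (w, v) j) ^+ m.
  rewrite [LHS](decouple indX [set inl k | k : 'I_n]%SET bF) /F /=.
  apply: eq_Rintegral => w _; apply: eq_Rintegral => v _; congr (_ ^+ _).
  rewrite exchange_big /=; apply: eq_bigr => j _; apply: eq_bigr => i _.
  rewrite mem_imset; last exact: inl_inj.
  rewrite inE /=; case: imsetP => //; by case.
pose GV w := gramsum [set: 'I_n]%SET [set: 'I_n]%SET w.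
rewrite -[X in (X / _)]/(\int[P]_w GV w ^+ q).
have bGV : bmeas GV by exact: bmeas_gramsum.
have bUm j : bmeas (fun z => column_sum z j ^+ m) by exact: bmeasX.
have bUm2 j : bmeas (fun w => \int[P]_v column_sum (w, v) j ^+ m) by exact:
  (bmeas_mean2 P (bUm j)).
have bcol : bmeas (fun w => \sum_j \int[P]_v column_sum (w, v) j ^+ m) by exact:
  bmeas_sum.
have bGq : bmeas (fun w => GV w ^+ q / m%:R ^+ q).
  by apply: bmeasM; [exact: bmeasX|exact: bmeas_cst].
apply: (@le_trans _ _ (\int[P]_w (rosenthal_cst R m * (GV w ^+ q / m%:R ^+ q +
    \sum_j \int[P]_v column_sum (w, v) j ^+ m)))).
  apply: ae_le_mean.
  - exact: (bmeas_mean2 P bUU).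
  - by apply: bmeasZ; exact: bmeasD.
  have : {ae P, forall w, forall i j, \int[P]_v h i j (X1 i w, X2 j v) = 0}.
    by do 2!apply: filter_forall => ?; exact: mean2_h.
  apply: filterS => w hw.
  have bf j : bmeas (fun y => \sum_i h i j (X1 i w, y)) by exact: bmeas_sum.
  have f0 j : \int[P]_v (\sum_i h i j (X1 i w, X2 j v)) = 0.
    by rewrite mean_sum//; exact: big1.
  have := rosenthal2 q0 bf f0; rewrite -/m -/(rosenthal_cst R m) => /le_trans; apply.
  rewrite ler_wpM2l ?rosenthal_cst_ge0// lerD2r /GV gramsumE le_eqVlt; apply/orP;
    left; apply/eqP.
  congr (_ ^+ _ / _); apply: eq_bigr => j _; apply: eq_Rintegral => v _.
  by congr (_ ^+ _); apply: eq_bigl => i; rewrite inE.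
rewrite meanZ; last exact: bmeasD.
rewrite ler_wpM2l ?rosenthal_cst_ge0// meanD// meanZr; last exact: bmeasX.
by rewrite lerD2l mean_sum.
Qed.

End Chaos.

(** * Numerical form of the even moment bound *)

Section Constants.
Context {R : realType}.
Implicit Types a b c D p : R.

(** Sum of the [p]-th roots of the four terms of the moment bound; half-integer powers of [p] are
    written with the square root. *)
Definition moment_scale p a b c D : R :=
  Num.sqrt p * c + p * D + Num.sqrt p ^+ 3 * b + p ^+ 2 * a.

(** The final estimate has five terms, each with coefficient at most the [m]-th power of
    [64 * expR 8]. *)
Definition moment_cst : R := 5 * (64 * expR 8).

Lemma expr_le (M N : R) (m : nat) : 0 <= M -> M <= N -> M ^+ m <= N ^+ m.
Proof. by move=> M0 MN; rewrite lerXn2r// nnegrE// (le_trans M0). Qed.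

Let expr4_split (p : R) (k : nat) :
  p ^+ (2 * (2 * k.+1)) = p ^+ k.+1 * (p ^+ 3) ^+ k * p ^+ 3.
Proof. by rewrite -exprM -!exprD; congr (_ ^+ _); lia. Qed.

Let expr4_split' (p : R) (k : nat) :
  p ^+ (2 * (2 * k.+1)) = (p ^+ 4) ^+ k * p ^+ 4.
Proof. by rewrite -exprM -!exprD; congr (_ ^+ _); lia. Qed.

(** Every term is a coefficient times [L^m], because [p c^2], [p^3 b^2] and [p^4 a^2] are at most
    [L^2]. The powers of [p] come from the Rosenthal constants through [m! <= m^m]. *)
Lemma even_moment_numeric (r : nat) a b c D (V U : R) : (0 < r)%N ->
  0 < a -> 0 < b -> 0 < c -> 0 < D ->
  let q := (2 * r)%N in let m := (2 * q)%N in
  V <= 2 * 4 ^+ q *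
      ((c ^+ 2) ^+ q + expR 2 ^+ q * (c ^+ 2 + q%:R * b ^+ 2) ^+ q) +
    ((8 * expR 2 * (Num.sqrt q%:R * D + q%:R * b)) ^+ q) ^+ 2 ->
  U <= rosenthal_cst R m * (V / m%:R ^+ q +
    rosenthal_cst R m * ((b ^+ 2) ^+ q.-1 / m%:R ^+ q + (a ^+ 2) ^+ q.-1) * c ^+ 2) ->
  U <= (moment_cst * moment_scale m%:R a b c D) ^+ m.
Proof.
move=> r0 a0 b0 c0 D0; set q := (2 * r)%N => /=; set m := (2 * q)%N.
have q0 : (0 < q)%N by rewrite muln_gt0.
have m0 : (0 < m)%N by rewrite muln_gt0.
set Vb := _ + _ ^+ 2; move=> VVb UV.
set p : R := m%:R.
have p1 : 1 <= p by rewrite /p ler1n.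
have p0 : 0 < p by rewrite (lt_le_trans _ p1).
have [a_ge0 b_ge0 c_ge0 D_ge0 p_ge0] :
  [/\ 0 <= a, 0 <= b, 0 <= c, 0 <= D & 0 <= p] by split; exact: ltW.
have qp : q%:R <= p by rewrite ler_nat leq_pmull.
set L := moment_scale p a b c D.
set s := Num.sqrt p; have s0 : 0 < s by rewrite sqrtr_gt0.
have s2 : s ^+ 2 = p by rewrite sqr_sqrtr// ltW.
have t0 : 0 < s * c by rewrite mulr_gt0.
have t1 : 0 < p * D by rewrite mulr_gt0.
have t2 : 0 < s ^+ 3 * b by rewrite mulr_gt0// exprn_gt0.
have t3 : 0 < p ^+ 2 * a by rewrite mulr_gt0// exprn_gt0.
have LE : L = s * c + p * D + s ^+ 3 * b + p ^+ 2 * a by [].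
have L0 : 0 < L by rewrite LE; lra.
have pq : p ^+ q = s ^+ m by rewrite -s2 -exprM.
have xL : p * c ^+ 2 <= L ^+ 2.
  rewrite -s2 -exprMn; apply: expr_le; first exact: ltW.
  by rewrite LE; lra.
have xyL : p * (c ^+ 2 + q%:R * b ^+ 2) <= L ^+ 2.
  apply: (@le_trans _ _ ((s * c + s ^+ 3 * b) ^+ 2)); last first.
    by apply: expr_le; [rewrite addr_ge0// ltW|rewrite LE; lra].
  have E : p * (p ^+ 2 * b ^+ 2) = (s ^+ 3 * b) ^+ 2 by rewrite -s2; ring.
  have H : p * (q%:R * b ^+ 2) <= p * (p ^+ 2 * b ^+ 2).
    rewrite ler_wpM2l ?(ltW p0)// ler_wpM2r ?sqr_ge0// (le_trans qp)//.
    by rewrite expr2 ler_peMl// ltW.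
  rewrite mulrDr sqrrD -E exprMn s2.
  have : 0 <= (s * c) * (s ^+ 3 * b) by rewrite mulr_ge0// ltW.
  by move: H; set u := p * (q%:R * _); set v := p * (_ * _); lra.
have yL : p ^+ 3 * b ^+ 2 <= L ^+ 2.
  have -> : p ^+ 3 * b ^+ 2 = (s ^+ 3 * b) ^+ 2 by rewrite -s2; ring.
  by apply: expr_le; [exact: ltW|rewrite LE; lra].
have zL : p ^+ 4 * a ^+ 2 <= L ^+ 2.
  have -> : p ^+ 4 * a ^+ 2 = (p ^+ 2 * a) ^+ 2 by ring.
  by apply: expr_le; [exact: ltW|rewrite LE; lra].
have RL : s * (Num.sqrt q%:R * D + q%:R * b) <= L.
  have sqs : Num.sqrt q%:R <= s by rewrite ler_wsqrtr.
  have H1 : s * (Num.sqrt q%:R * D) <= p * D.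
    by rewrite mulrA ler_wpM2r ?(ltW D0)// -s2 expr2 ler_wpM2l ?(ltW s0).
  have H2 : s * (q%:R * b) <= s ^+ 3 * b.
    by rewrite mulrA ler_wpM2r ?(ltW b0)// exprS s2 ler_wpM2l ?(ltW s0).
  by rewrite mulrDr LE; lra.
set e := expR 1 : R.
have e1 : 1 <= e by have := expR_ge1Dx (1 : R); rewrite /e; lra.
have e0 : 0 <= e by exact: expR_ge0.
have eX (k : nat) : expR k%:R = e ^+ k by rewrite /e -expRM_natl mulr1.
have CpE : rosenthal_cst R m <= p ^+ m * (e ^+ 4) ^+ m.
  rewrite /rosenthal_cst -/p -(eX 4) expRM_natr ler_wpM2r ?exprn_ge0 ?expR_ge0//.
  by rewrite -natrX ler_nat leq_fact_exp.
have pn0 : p != 0 by rewrite gt_eqF.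
pose M : R := 64 * e ^+ 8.
have en k : 1 <= e ^+ k by exact: exprn_ege1.
have M0 : 0 <= M by rewrite mulr_ge0// (le_trans _ (en 8)).
have LmE : L ^+ m = (L ^+ 2) ^+ q by rewrite -exprM.
have LmE' : L ^+ m = (L ^+ 2) ^+ q.-1 * L ^+ 2 by rewrite LmE -exprSr prednK.
have B1 : p ^+ q * (c ^+ 2) ^+ q <= L ^+ m.
  rewrite -exprMn LmE; apply: expr_le => //.
  by rewrite mulr_ge0 ?sqr_ge0// ltW.
have B2 : p ^+ q * (c ^+ 2 + q%:R * b ^+ 2) ^+ q <= L ^+ m.
  rewrite -exprMn LmE; apply: expr_le => //.
  by rewrite mulr_ge0 ?addr_ge0 ?mulr_ge0 ?sqr_ge0// ltW.
have B3 : p ^+ q * ((8 * e ^+ 2 * (Num.sqrt q%:R * D + q%:R * b)) ^+ q) ^+ 2 <=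
    (8 * e ^+ 2) ^+ m * L ^+ m.
  rewrite pq -exprM [(q * 2)%N]mulnC -/m -exprMn mulrCA exprMn.
  rewrite ler_wpM2l ?exprn_ge0 ?mulr_ge0 ?exprn_ge0//.
  apply: expr_le => //; rewrite mulr_ge0 ?(ltW s0)//.
  by rewrite addr_ge0// mulr_ge0 ?sqrtr_ge0 ?(ltW D0) ?(ltW b0).
have x0 : 0 <= p * c ^+ 2 by rewrite mulr_ge0 ?sqr_ge0 ?(ltW p0).
have y0 : 0 <= p ^+ 3 * b ^+ 2 by rewrite mulr_ge0 ?sqr_ge0 ?exprn_ge0 ?(ltW p0).
have z0 : 0 <= p ^+ 4 * a ^+ 2 by rewrite mulr_ge0 ?sqr_ge0 ?exprn_ge0 ?(ltW p0).
(* The two Rosenthal constants contribute [p^(2m)]. The single factor [c^2] uses up only one [p], so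
   a surplus [p^2] remains here, and [p^3] in the next bound. *)
have B4 : p ^+ (2 * m) * ((b ^+ 2) ^+ q.-1 / p ^+ q) * c ^+ 2 <= p ^+ 2 * L ^+ m.
  have -> : p ^+ (2 * m) * ((b ^+ 2) ^+ q.-1 / p ^+ q) * c ^+ 2 =
      p ^+ 2 * ((p ^+ 3 * b ^+ 2) ^+ q.-1 * (p * c ^+ 2)).
    rewrite /m -(prednK q0) expr4_split /= [(p ^+ 3 * _) ^+ _]exprMn.
    by field; rewrite expf_neq0.
  rewrite ler_wpM2l ?sqr_ge0// LmE'.
  by apply: ler_pM => //; [exact: exprn_ge0|exact: expr_le].
have B5 : p ^+ (2 * m) * (a ^+ 2) ^+ q.-1 * c ^+ 2 <= p ^+ 3 * L ^+ m.
  have -> : p ^+ (2 * m) * (a ^+ 2) ^+ q.-1 * c ^+ 2 =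
      p ^+ 3 * ((p ^+ 4 * a ^+ 2) ^+ q.-1 * (p * c ^+ 2)).
    by rewrite /m -(prednK q0) expr4_split' /= [(p ^+ 4 * _) ^+ _]exprMn; ring.
  rewrite ler_wpM2l ?exprn_ge0 ?(ltW p0)// LmE'.
  by apply: ler_pM => //; [exact: exprn_ge0|exact: expr_le].
have Lm0 : 0 <= L ^+ m by rewrite exprn_ge0// ltW.
(* This absorbs the surplus powers of [p] into an [m]-th power: [p^3 <= 8^m]. *)
have p2 : p <= 2 ^+ m by rewrite -natrX ler_nat ltnW// ltn_expl.
have M1 (k l : R) : 0 <= k -> k <= l -> k ^+ m <= l ^+ m by exact: expr_le.
have e4_le j k : (j <= k)%N -> e ^+ j <= e ^+ k by exact: ler_weXn2l.
have Vpq : V / p ^+ q <= p ^- m * (p ^+ q * Vb).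
  have -> : p ^- m * (p ^+ q * Vb) = Vb / p ^+ q.
    rewrite (_ : p ^+ m = p ^+ q * p ^+ q); last by rewrite -exprD addnn -mul2n.
    by field; rewrite expf_neq0.
  by rewrite ler_wpM2r// invr_ge0 exprn_ge0// ltW.
pose C := p ^+ m * (e ^+ 4) ^+ m.
have C0 : 0 <= C by rewrite mulr_ge0 ?exprn_ge0 ?(ltW p0) .
have Q0 : 0 <= (b ^+ 2) ^+ q.-1 / p ^+ q + (a ^+ 2) ^+ q.-1.
  by rewrite addr_ge0 ?divr_ge0 ?exprn_ge0.
have U1 : U <= (e ^+ 4) ^+ m * (p ^+ q * Vb) +
    (e ^+ 4) ^+ m * (e ^+ 4) ^+ m * (p ^+ 2 * L ^+ m + p ^+ 3 * L ^+ m).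
  apply: (le_trans UV).
  apply: (@le_trans _ _ (C * (p ^- m * (p ^+ q * Vb) + C *
      ((b ^+ 2) ^+ q.-1 / p ^+ q + (a ^+ 2) ^+ q.-1) * c ^+ 2))).
    have Cp0 := rosenthal_cst_ge0 R m.
    have W0 : 0 <= p ^- m * (p ^+ q * Vb) + C *
      ((b ^+ 2) ^+ q.-1 / p ^+ q + (a ^+ 2) ^+ q.-1) * c ^+ 2.
      rewrite addr_ge0//; last by rewrite mulr_ge0 ?sqr_ge0// mulr_ge0.
      rewrite mulr_ge0 ?invr_ge0 ?exprn_ge0 ?(ltW p0)// mulr_ge0 ?exprn_ge0 ?(ltW p0)//.
      rewrite addr_ge0 ?sqr_ge0// mulr_ge0 ?mulr_ge0 ?exprn_ge0//.
      rewrite addr_ge0 ?mulr_ge0 ?exprn_ge0 ?sqr_ge0 ?expR_ge0//.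
      by rewrite addr_ge0 ?mulr_ge0 ?sqr_ge0.
    apply: (@le_trans _ _ (rosenthal_cst R m * (p ^- m * (p ^+ q * Vb) + C *
      ((b ^+ 2) ^+ q.-1 / p ^+ q + (a ^+ 2) ^+ q.-1) * c ^+ 2))).
      rewrite ler_wpM2l// lerD// ler_wpM2r ?sqr_ge0// ler_wpM2r//.
    by rewrite ler_wpM2r.
  have -> : C * (p ^- m * (p ^+ q * Vb) + C *
      ((b ^+ 2) ^+ q.-1 / p ^+ q + (a ^+ 2) ^+ q.-1) * c ^+ 2) =
      (e ^+ 4) ^+ m * (p ^+ q * Vb) + (e ^+ 4) ^+ m * (e ^+ 4) ^+ m *
      (p ^+ (2 * m) * ((b ^+ 2) ^+ q.-1 / p ^+ q) * c ^+ 2 +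
       p ^+ (2 * m) * (a ^+ 2) ^+ q.-1 * c ^+ 2).
    rewrite /C mulrDr; congr (_ + _).
      have H : p ^+ m * p ^- m = 1 by rewrite mulfV// expf_neq0.
      by rewrite -[RHS]mul1r -H; ring.
    by rewrite mul2n -addnn exprD; ring.
  by rewrite lerD2l ler_wpM2l ?mulr_ge0 ?exprn_ge0 ?exprn_ge0// lerD.
have E2 : expR 2 = e ^+ 2 :> R by rewrite -eX.
have Vb1 : p ^+ q * Vb <= (2 * 4 ^+ q + 2 * 4 ^+ q * (e ^+ 2) ^+ q + (8 * e ^+ 2) ^+
  m) * L ^+ m.
  rewrite /Vb E2 mulrDr [leRHS]mulrDl; apply: lerD => //.
  have H := lerD B1 (ler_wpM2l (exprn_ge0 q (exprn_ge0 2 e0)) B2).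
  have n40 : 0 <= 2 * 4 ^+ q :> R by rewrite mulr_ge0 ?exprn_ge0.
  by apply: le_trans (le_trans (ler_wpM2l n40 H) _);
    rewrite le_eqVlt; apply/orP; left; apply/eqP; ring.
have n4 : 2 * 4 ^+ q <= 8 ^+ m :> R.
  have -> : 8 ^+ m = 4 ^+ q * 16 ^+ q :> R.
    by rewrite -exprMn /m exprM; congr (_ ^+ _); ring.
  rewrite mulrC ler_wpM2l ?exprn_ge0// (le_trans _ (ler_eXnr q0 _))//; lra.
have K0M : moment_cst = 5 * M by rewrite /moment_cst /M (eX 8).
have M5 : 5 * M ^+ m <= moment_cst ^+ m.
  rewrite K0M [(5 * M) ^+ m]exprMn ler_wpM2r ?exprn_ge0// (le_trans _ (ler_eXnr m0
    _))//; lra.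
rewrite [(moment_cst * L) ^+ m]exprMn (le_trans U1)//.
apply: (@le_trans _ _ (5 * M ^+ m * L ^+ m)); last by rewrite ler_wpM2r.
have e8M k : (k <= 8)%N -> 8 * e ^+ k <= M.
  by move=> k8; apply: ler_pM; rewrite ?exprn_ge0 ?ler_nat ?e4_le.
pose E4 := (e ^+ 4) ^+ m.
have E40 : 0 <= E4 by rewrite exprn_ge0// exprn_ge0.
have c1 : E4 * (2 * 4 ^+ q) <= M ^+ m.
  apply: (@le_trans _ _ (E4 * 8 ^+ m)); first by rewrite ler_wpM2l.
  rewrite /E4 -exprMn; apply: M1; first by rewrite mulr_ge0// exprn_ge0//.
  by rewrite mulrC e8M.
have c2 : E4 * (2 * 4 ^+ q * (e ^+ 2) ^+ q) <= M ^+ m.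
  apply: (@le_trans _ _ (E4 * (8 ^+ m * e ^+ m))).
    rewrite ler_wpM2l// -[(e ^+ 2) ^+ q]exprM -/m ler_wpM2r// exprn_ge0// e0//.
  rewrite /E4 -!exprMn; apply: M1.
    by rewrite mulr_ge0// ?mulr_ge0// ?exprn_ge0// e0.
  have -> : e ^+ 4 * (8 * e) = 8 * e ^+ 5 by ring.
  exact: e8M.
have c3 : E4 * (8 * e ^+ 2) ^+ m <= M ^+ m.
  rewrite /E4 -!exprMn; apply: M1.
    by rewrite mulr_ge0// ?mulr_ge0// ?exprn_ge0// exprn_ge0.
  have -> : e ^+ 4 * (8 * e ^+ 2) = 8 * e ^+ 6 by ring.
  exact: e8M.
have c5 k : (k <= 3)%N -> E4 * E4 * p ^+ k <= M ^+ m.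
  move=> k3; apply: (@le_trans _ _ (E4 * E4 * 8 ^+ m)).
    rewrite ler_wpM2l ?mulr_ge0// (@le_trans _ _ (p ^+ 3))//; first exact: ler_weXn2l.
    have -> : 8 ^+ m = (2 ^+ m) ^+ 3 :> R.
      by rewrite -exprM mulnC exprM; congr (_ ^+ _); ring.
    by apply: expr_le => //; exact: ltW.
  have -> : E4 * E4 * 8 ^+ m = (8 * e ^+ 8) ^+ m.
    by rewrite /E4 -!exprMn; congr (_ ^+ _); ring.
  apply: M1; first by rewrite mulr_ge0 ?exprn_ge0.
  exact: e8M.
have := ler_wpM2l E40 Vb1; have := c5 2%N isT; have := c5 3%N isT.
move: c1 c2 c3; rewrite -/E4; move: (M ^+ m) => Mm c1 c2 c3 c4 c6 c7.
apply: (le_trans (lerD c7 (lexx _))).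
have -> : E4 * ((2 * 4 ^+ q + 2 * 4 ^+ q * (e ^+ 2) ^+ q + (8 * e ^+ 2) ^+ m) * L ^+
  m) +
    E4 * E4 * (p ^+ 2 * L ^+ m + p ^+ 3 * L ^+ m) =
    (E4 * (2 * 4 ^+ q) + E4 * (2 * 4 ^+ q * (e ^+ 2) ^+ q) +
     E4 * (8 * e ^+ 2) ^+ m + E4 * E4 * p ^+ 2 + E4 * E4 * p ^+ 3) * L ^+ m by ring.
rewrite ler_wpM2r// (_ : 5 * Mm = Mm + Mm + Mm + Mm + Mm); last by ring.
by do !apply: lerD.
Qed.

End Constants.
Arguments moment_cst : clear implicits.

(** * From the extended-real parameters to the bounds on the kernels *)

Section ParamBounds.
Context {R : realType} {d d' : measure_display}.
Context {Omega : measurableType d} {S : measurableType d'}.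
Variables (P : probability Omega R) (n : nat).
Variables (X1 X2 : 'I_n -> {RV P >-> S}) (h : 'I_n -> 'I_n -> S * S -> R).
Hypothesis indX : mutually_independent (family12 X1 X2).
Hypothesis mh : forall i j, measurable_fun setT (h i j).
Hypothesis boundh : bounded_kernels h.
Hypothesis canh : canonical_kernels X1 X2 h.

Let bh i j : bmeas (h i j).
Proof. by split. Qed.

(** Decoupling at [inl i] turns the joint law of the pair into the product of its marginals. *)
Lemma mean_pair (F : S * S -> R) i j : bmeas F ->
  \int[P]_w F (X1 i w, X2 j w) = \int[P]_w \int[P]_v F (X1 i w, X2 j v).
Proof.
move=> bF; pose G (x : vect ('I_n + 'I_n)%type S) : R := F (x (inl i), x (inr j)).
have bG : bmeas G.
  apply: (bmeas_comp bF).
  by apply: measurable_fun_pair; exact: measurable_coord.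
rewrite [LHS](decouple indX [set inl i]%SET bG) /G /=.
by under eq_Rintegral => w _ do under eq_Rintegral => v _ do rewrite !inE eqxx /=.
Qed.

Lemma paramA_ge0 : (0 <= paramA h)%E.
Proof. exact: bigmax_ge_id. Qed.

Lemma paramB_ge0 : (0 <= paramB X1 X2 h)%E.
Proof. exact: sqrte_ge0. Qed.

Lemma paramC_ge0 : (0 <= paramC X1 X2 h)%E.
Proof. exact: sqrte_ge0. Qed.

Lemma paramD_ge0 : (0 <= paramD X1 X2 h)%E.
Proof.
apply: ereal_sup_ubound; exists (fun _ _ => 0), (fun _ _ => 0); split.
- by split=> ?; exact: measurable_cst.
- by under eq_fun do under eq_bigr do rewrite expr0n /=; rewrite expectation_mean
  ?mean_cst ?big1//; exact: bmeas_cst.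
- by under eq_fun do under eq_bigr do rewrite expr0n /=; rewrite expectation_mean
  ?mean_cst ?big1//; exact: bmeas_cst.
- under eq_fun do under eq_bigr do under eq_bigr do rewrite mulr0.
  rewrite expectation_mean ?mean_cst; last exact: bmeas_cst.
  by rewrite big1// => i _; rewrite big1.
Qed.

Lemma paramA_le a : paramA h = a%:E -> forall i j z, `|h i j z| <= a.
Proof.
move=> ha i j z; rewrite -lee_fin -ha.
apply: (@le_trans _ _ (supnorm (EFin \o h i j))).
  by apply: ereal_sup_ubound; exists z.
apply: (le_trans (le_bigmax 0%E (fun j => supnorm (EFin \o h i j)) j)).
exact: (le_bigmax 0%E (fun i => \big[maxe/0%E]_j supnorm (EFin \o h i j)) i).
Qed.

Lemma paramB_le b : paramB X1 X2 h = b%:E ->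
  (forall j y, \sum_i \int[P]_w h i j (X1 i w, y) ^+ 2 <= b ^+ 2) /\
  (forall i x, \sum_j \int[P]_v h i j (x, X2 j v) ^+ 2 <= b ^+ 2).
Proof.
rewrite /paramB; set M := maxe _ _ => hb.
have M0 : (0 <= M)%E by rewrite le_max bigmax_ge_id.
have Mb : M = (b ^+ 2)%:E by rewrite -(sqr_sqrte M0) hb EFin_expe.
split=> [j y|i x]; rewrite -lee_fin -Mb le_max; apply/orP; [left|right].
- set F := fun y : S => (\sum_i E1 X1 i (fun x => (h i j (x, y) ^+ 2)%R))%E.
  apply: (@le_trans _ _ (F y)).
    rewrite -sumEFin le_eqVlt; apply/orP; left; apply/eqP; apply: eq_bigr => i _.
    rewrite /E1 expectation_mean//; apply: bmeasX.
    by apply: (bmeas_comp (bmeas_slice1 y (bh i j))).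
  apply: (@le_trans _ _ (supnorm F)).
    by apply: (le_trans (lee_abs _)); apply: ereal_sup_ubound; exists y.
  exact: (le_bigmax 0%E (fun j => supnorm (fun y : S =>
    (\sum_i E1 X1 i (fun x => (h i j (x, y) ^+ 2)%R))%E)) j).
- set F := fun x : S => (\sum_j E2 X2 j (fun y => (h i j (x, y) ^+ 2)%R))%E.
  apply: (@le_trans _ _ (F x)).
    rewrite -sumEFin le_eqVlt; apply/orP; left; apply/eqP; apply: eq_bigr => j _.
    rewrite /E2 expectation_mean//; apply: bmeasX.
    by apply: (bmeas_comp (bmeas_slice2 x (bh i j))).
  apply: (@le_trans _ _ (supnorm F)).
    by apply: (le_trans (lee_abs _)); apply: ereal_sup_ubound; exists x.
  exact: (le_bigmax 0%E (fun i => supnorm (fun x : S =>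
    (\sum_j E2 X2 j (fun y => (h i j (x, y) ^+ 2)%R))%E)) i).
Qed.

Lemma paramC_le c : paramC X1 X2 h = c%:E ->
  \sum_i \sum_j \int[P]_w \int[P]_v h i j (X1 i w, X2 j v) ^+ 2 <= c ^+ 2.
Proof.
rewrite /paramC; set M := (\sum_i _)%E => hc.
have M0 : (0 <= M)%E.
  by do 2!(apply: sume_ge0 => ? _); apply: expectation_ge0 => w; exact: sqr_ge0.
rewrite -lee_fin EFin_expe -hc sqr_sqrte// /M -sumEFin.
rewrite le_eqVlt; apply/orP; left; apply/eqP; apply: eq_bigr => i _.
rewrite -sumEFin; apply: eq_bigr => j _.
have bF := bmeasX 2 (bh i j).
rewrite expectation_mean ?(mean_pair i j bF)//.
by apply: (bmeas_comp bF); exact: measurable_fun_pair.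
Qed.

(* Duality: [f_i] is taken proportional to the function whose norm is to be bounded. *)
Lemma paramD_le D (g : 'I_n -> S -> R) (t : R) : paramD X1 X2 h = D%:E -> 0 < t ->
  (forall j, bmeas (g j)) -> \sum_j \int[P]_v g j (X2 j v) ^+ 2 <= t ^+ 2 ->
  \sum_i \int[P]_w
    (\sum_j \int[P]_v (h i j (X1 i w, X2 j v) * g j (X2 j v))) ^+ 2 <=
  D ^+ 2 * t ^+ 2.
Proof.
move=> hD t0 bg gt.
pose F i x : R := \sum_j \int[P]_v (h i j (x, X2 j v) * g j (X2 j v)).
rewrite -[X in X <= _]/(\sum_i \int[P]_w F i (X1 i w) ^+ 2).
have bF i : bmeas (F i).
  apply: bmeas_sum => j; apply: (@bmeas_mean2 _ _ _ _ _ _ (fun z : S * Omega =>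
    h i j (z.1, X2 j z.2) * g j (X2 j z.2))).
  apply: bmeasM.
    apply: (bmeas_comp (bh i j)); apply: measurable_fun_pair => //.
    exact: measurableT_comp.
  by apply: (bmeas_comp (bg j)); exact: measurableT_comp.
have bFX i : bmeas (fun w => F i (X1 i w)) by apply: (bmeas_comp (bF i)).
have bgX j : bmeas (fun v => g j (X2 j v)) by apply: (bmeas_comp (bg j)).
set N := \sum_i _.
have : 0 <= N by apply: sumr_ge0 => i _; apply: mean_ge0 => w; exact: sqr_ge0.
rewrite le_eqVlt => /orP[/eqP <-|N0]; first by rewrite mulr_ge0 ?sqr_ge0.
set s := Num.sqrt N; have s0 : 0 < s by rewrite sqrtr_gt0.
have sN : s ^+ 2 = N by rewrite sqr_sqrtr// ltW.
have sn0 : s != 0 by rewrite gt_eqF.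
have tn0 : t != 0 by rewrite gt_eqF.
(* The test functions [F i / s] and [g j / t] are admissible and their pairing is [s^2 / (s t)]. *)
suff : s / t <= D.
  rewrite ler_pdivrMr// => sDt; rewrite -sN -exprMn lerXn2r ?nnegrE ?(ltW s0)//.
  by rewrite (le_trans _ sDt)// ltW.
rewrite -lee_fin -hD; apply: ereal_sup_ubound.
exists (fun i x => s^-1 * F i x), (fun j y => t^-1 * g j y); split.
- by split=> [i|j]; [have [] := bmeasZ s^-1 (bF i)|have [] := bmeasZ t^-1 (bg j)].
- have bf i : bmeas (fun w => (s^-1 * F i (X1 i w)) ^+ 2) by apply/bmeasX/bmeasZ.
  rewrite expectation_mean; last exact: bmeas_sum.
  rewrite mean_sum//.
  under eq_bigr => i _.
    under eq_fun do rewrite exprMn.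
    rewrite meanZ; last exact: bmeasX.
    over.
  by rewrite -mulr_sumr -/N -sN -exprMn mulVf// expr1n.
- have bf j : bmeas (fun v => (t^-1 * g j (X2 j v)) ^+ 2) by apply/bmeasX/bmeasZ.
  rewrite expectation_mean; last exact: bmeas_sum.
  rewrite mean_sum//.
  under eq_bigr => j _.
    under eq_fun do rewrite exprMn.
    rewrite meanZ; last exact: bmeasX.
    over.
  by rewrite -mulr_sumr lee_fin exprVn ler_pdivrMl ?exprn_gt0// mulr1.
- pose H i j (z : S * S) : R := h i j z * (s^-1 * F i z.1) * (t^-1 * g j z.2).
  have bH i j : bmeas (H i j).
    apply: bmeasM; first apply: bmeasM => //.
      by apply: bmeasZ; apply: (bmeas_comp (bF i)).
    by apply: bmeasZ; apply: (bmeas_comp (bg j)).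
  have bHX i j : bmeas (fun w => H i j (X1 i w, X2 j w)).
    by apply: (bmeas_comp (bH i j)); exact: measurable_fun_pair.
  rewrite (@expectation_mean _ _ _ _ (fun w => \sum_i \sum_j H i j (X1 i w, X2 j w)));
    last by do 2!apply: bmeas_sum => ?.
  congr EFin; rewrite mean_sum; last by move=> i; exact: bmeas_sum.
  have -> : s / t = s^-1 * t^-1 * N by rewrite -sN; field; rewrite sn0 tn0.
  rewrite /N mulr_sumr; apply: eq_bigr => i _.
  rewrite mean_sum// -meanZ; last exact: bmeasX.
  transitivity (\int[P]_w \sum_j \int[P]_v H i j (X1 i w, X2 j v)); last first.
    rewrite mean_sum; first by apply: eq_bigr => j _; rewrite mean_pair.
    move=> j; apply: (@bmeas_mean2 _ _ _ _ _ _ (fun z : Omega * Omega =>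
      H i j (X1 i z.1, X2 j z.2))).
    apply: (bmeas_comp (bH i j)).
    by apply: measurable_fun_pair; apply: measurableT_comp.
  apply: eq_Rintegral => w _; rewrite expr2 [X in _ * (_ * X)]/F 2!mulr_sumr.
  apply: eq_bigr => j _; rewrite mulrA -meanZ.
    by apply: eq_Rintegral => v _; rewrite /H /=; ring.
  by apply: bmeasM => //; apply: (bmeas_comp (bmeas_slice2 (X1 i w) (bh i j))).
Qed.

Lemma moment_scale_perturb (p a b c D e : R) :
  moment_scale p (a + e) (b + e) (c + e) (D + e) =
  moment_scale p a b c D + e * moment_scale p 1 1 1 1.
Proof. by rewrite /moment_scale; ring. Qed.

(* The strict inequality leaves room to replace [a], [b], [c], [D], which may vanish, by
   slightly larger positive numbers. *)
Lemma even_moment (r : nat) (a b c D L : R) : (0 < r)%N ->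
  paramA h = a%:E -> paramB X1 X2 h = b%:E -> paramC X1 X2 h = c%:E ->
  paramD X1 X2 h = D%:E ->
  let m := (2 * (2 * r))%N in
  moment_cst R * moment_scale m%:R a b c D < L ->
  \int[P]_w Ustat X1 X2 h w ^+ m <= L ^+ m.
Proof.
move=> r0 hA hB hC hD; set m := (2 * (2 * r))%N => /= KL.
have a0 : 0 <= a by rewrite -lee_fin -hA paramA_ge0.
have b0 : 0 <= b by rewrite -lee_fin -hB paramB_ge0.
have c0 : 0 <= c by rewrite -lee_fin -hC paramC_ge0.
have D0 : 0 <= D by rewrite -lee_fin -hD paramD_ge0.
have m0 : 0 < m%:R :> R by rewrite ltr0n !muln_gt0.
have moment_cst_gt0 : 0 < moment_cst R by rewrite /moment_cst !mulr_gt0// expR_gt0.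
have l1 : 0 < moment_scale m%:R 1 1 1 1 :> R.
  have s0 : 0 < Num.sqrt m%:R :> R by rewrite sqrtr_gt0.
  by rewrite /moment_scale !mulr1 !addr_gt0// exprn_gt0.
(* The scale is linear in its last four arguments; this [e] spends the gap exactly, making [L] the
   bound for the perturbed parameters. *)
pose e := (L - moment_cst R * moment_scale m%:R a b c D) / (moment_cst R *
  moment_scale m%:R 1 1 1 1).
have e0 : 0 < e by rewrite divr_gt0 ?subr_gt0// mulr_gt0.
have LE : L = moment_cst R * moment_scale m%:R (a + e) (b + e) (c + e) (D + e).
  rewrite moment_scale_perturb /e; field.
  by rewrite !gt_eqF.
have [ae be ce De] : [/\ 0 < a + e, 0 < b + e, 0 < c + e & 0 < D + e].
  by split; rewrite ltr_wpDl.
have sqr_le (x : R) : 0 <= x -> x ^+ 2 <= (x + e) ^+ 2.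
  by move=> x0; rewrite lerXn2r ?nnegrE ?addr_ge0// ?(ltW e0)// lerDl ltW.
have [hB1 hB2] := paramB_le hB.
have mean1 i j : {ae P, forall v, \int[P]_w h i j (X1 i w, X2 j v) = 0}.
  have [+ _] := canh i j; apply: filterS => v /=.
  rewrite /E1 expectation_mean; first by move=> [].
  by apply: (bmeas_comp (bmeas_slice1 (X2 j v) (bh i j))).
have mean2 i j : {ae P, forall w, \int[P]_v h i j (X1 i w, X2 j v) = 0}.
  have [_ +] := canh i j; apply: filterS => w /=.
  rewrite /E2 expectation_mean; first by move=> [].
  by apply: (bmeas_comp (bmeas_slice2 (X1 i w) (bh i j))).
have kA i j z : `|h i j z| <= a + e.
  by rewrite (le_trans (paramA_le hA i j z))// lerDl ltW.
have kB1 j y := le_trans (hB1 j y) (sqr_le b b0).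
have kB2 i x := le_trans (hB2 i x) (sqr_le b b0).
have kC := le_trans (paramC_le hC) (sqr_le c c0).
have kD (g : 'I_n -> S -> R) (t : R) (t0 : 0 < t) (bg : forall j, bmeas (g j)) gt :=
  le_trans (@paramD_le D g t hD t0 bg gt) (ler_wpM2r (sqr_ge0 t) (sqr_le D D0)).
rewrite LE; have q0 : (0 < 2 * r)%N by rewrite muln_gt0.
apply: (even_moment_numeric r0 ae be ce De _
  (Ustat_moment indX bh mean1 mean2 ae be kA kB1 kC q0)).
have bV : bmeas (gramsum X1 X2 h [set: 'I_n]%SET [set: 'I_n]%SET).
  exact: bmeas_gramsum.
apply: (le_trans _ (gramsum_moment indX bh mean1 be ce De kB2 kC kD _ r0)).
apply: le_mean => [||w].
- exact: bmeasX.
- by apply/bmeasX/bmeasD; [exact: bV|exact: bmeas_cst].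
have V0 := gramsum_ge0 X1 X2 bh [set: 'I_n]%SET w.
by rewrite lerXn2r ?nnegrE ?addr_ge0 ?sqr_ge0// lerDl sqr_ge0.
Qed.

End ParamBounds.

(** * Interpolation to real exponents and Markov's inequality *)

Section RealMoments.
Context {R : realType} {d : measure_display} {Omega : measurableType d}.
Variable P : probability Omega R.

Lemma le_of_lt_bounds (x y : R) : (forall z, x < z -> y <= z) -> y <= x.
Proof.
move=> H; rewrite leNgt; apply/negP => xy.
by have := H _ (midf_lt xy).1; rewrite leNgt (midf_lt xy).2.
Qed.

Lemma expr_even_norm (x : R) (m : nat) : ~~ odd m -> `|x| ^+ m = x ^+ m.
Proof.
by move=> em; rewrite -(even_halfK em) -mul2n !exprM real_normK ?num_real.
Qed.

Lemma bmeas_powR (f : Omega -> R) (p : R) : bmeas f -> 0 <= p ->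
  bmeas (fun w => `|f w| `^ p).
Proof.
move=> bf p0; have [mf [M fM]] := bmeas_norm bf; split.
  exact: measurableT_comp (measurable_powR p) mf.
exists (M `^ p) => w; rewrite ger0_norm ?powR_ge0//.
have := fM w; rewrite normr_id => fwM.
by rewrite ge0_ler_powR// nnegrE// (le_trans _ fwM).
Qed.

(* Interpolation: [u^p <= L^p + L^(p - m) u^m] for all [u], and the two terms on the right
   contribute equally to the mean. *)
Lemma real_moment_le (f : Omega -> R) (p L0 : R) (m : nat) : bmeas f -> 0 < p ->
  p <= m%:R -> ~~ odd m -> 0 <= L0 ->
  (forall L, L0 < L -> \int[P]_w f w ^+ m <= L ^+ m) ->
  \int[P]_w `|f w| `^ p <= 2 * L0 `^ p.
Proof.
move=> bf p0 pm em L00 H; set y := \int[P]_w _.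
have y0 : 0 <= y by apply: mean_ge0 => w; exact: powR_ge0.
have bfp : bmeas (fun w => `|f w| `^ p) by apply: bmeas_powR => //; exact: ltW.
have step L : L0 < L -> y <= 2 * L `^ p.
  move=> LL; have L_gt0 : 0 < L by exact: le_lt_trans LL.
  apply: (@le_trans _ _ (\int[P]_w (L `^ p + L `^ (p - m%:R) * f w ^+ m))).
    apply: le_mean => //[|w].
      by apply: bmeasD; [exact: bmeas_cst|apply: bmeasZ; exact: bmeasX].
    rewrite -(expr_even_norm _ em); have [fL|Lf] := leP `|f w| L.
      rewrite -[leLHS]addr0 lerD ?mulr_ge0 ?powR_ge0 ?exprn_ge0//.
      by rewrite ge0_ler_powR ?nnegrE ?(ltW p0) ?(ltW L_gt0).
    have f0 : 0 < `|f w| by exact: lt_trans Lf.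
    rewrite -[leLHS]add0r lerD ?powR_ge0// -powR_mulrn//.
    rewrite -[in leLHS](subrK m%:R p) [leLHS]powRD; last by apply/implyP => _;
      rewrite gt_eqF.
        rewrite ler_wpM2r ?powR_ge0// -(opprB m%:R) !powRN lef_pV2 ?posrE ?powR_gt0//.
    by rewrite ge0_ler_powR ?subr_ge0 ?nnegrE ?(ltW L_gt0)// ltW.
  rewrite meanD ?mean_cst ?meanZ; [|exact: bmeasX|exact: bmeas_cst|]; last first.
    by apply: bmeasZ; exact: bmeasX.
  have := ler_wpM2l (powR_ge0 L (p - m%:R)) (H L LL).
  rewrite -[in X in _ <= X](powR_mulrn _ (ltW L_gt0)) -powRD; last first.
    by apply/implyP => _; rewrite gt_eqF.
  by rewrite subrK; lra.
have pn0 : p != 0 by rewrite gt_eqF.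
(* Taking [p]-th roots passes from all [L > L0] to [L0] itself, also when [L0 = 0]. *)
suff : (y / 2) `^ p^-1 <= L0.
  move=> /(ge0_ler_powR (ltW p0)); rewrite !nnegrE powR_ge0 => /(_ isT L00).
  by rewrite -powRrM mulVf// powRr1 ?divr_ge0//; lra.
apply: le_of_lt_bounds => L LL; have L_gt0 : 0 < L by exact: le_lt_trans LL.
have -> : L = (L `^ p) `^ p^-1 by rewrite -powRrM mulfV// powRr1// ltW.
rewrite ge0_ler_powR ?invr_ge0 ?(ltW p0) ?nnegrE ?divr_ge0 ?powR_ge0//.
by have := step L LL; lra.
Qed.

Lemma measurable_norm_ge (f : Omega -> R) (x : R) : bmeas f ->
  measurable [set w | (x <= `|f w|)%R].
Proof.
move=> /bmeas_norm[mf _].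
rewrite (_ : [set w | _] = (fun w => `|f w|) @^-1` `[x, +oo[%classic).
  by rewrite -[X in measurable X]setTI; exact: mf.
by apply/seteqP; split=> w /=; rewrite in_itv/= andbT.
Qed.

Lemma markov_even (f : Omega -> R) (m : nat) (x : R) : bmeas f -> 0 < x ->
  ~~ odd m ->
  (P [set w | (x <= `|f w|)%R] <= (\int[P]_w f w ^+ m / x ^+ m)%R%:E)%E.
Proof.
move=> bf x0 em; set A := [set w | _].
have mA : measurable A by exact: measurable_norm_ge.
have bA : bmeas (\1_A : Omega -> R).
  split; first exact: measurable_indic.
  by exists 1 => w; rewrite indicE ger0_norm ?ler0n// lern1 leq_b1.
rewrite -expectation_indic// expectation_mean// lee_fin.
have bfm : bmeas (fun w => f w ^+ m / x ^+ m).
  by apply: bmeasM; [exact: bmeasX|exact: bmeas_cst].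
rewrite -meanZr; last exact: bmeasX.
apply: le_mean => // w; rewrite indicE -(expr_even_norm _ em).
have [wA|wA] := boolP (w \in A).
  rewrite ler_pdivlMr ?exprn_gt0// mul1r; apply: expr_le; first exact: ltW.
  by move: wA; rewrite inE.
by rewrite divr_ge0 ?exprn_ge0// ltW.
Qed.

End RealMoments.

(** * Comparison of the moment scale with the moment bound and with the tail level *)

Section LamBounds.
Context {R : realType}.
Implicit Types a b c D p : R.

Lemma moment_scale_ge0 p a b c D : 0 <= p -> 0 <= a -> 0 <= b -> 0 <= c -> 0 <= D ->
  0 <= moment_scale p a b c D.
Proof.
by move=> p0 a0 b0 c0 D0; rewrite !addr_ge0// mulr_ge0// ?exprn_ge0 ?sqrtr_ge0.
Qed.

(** The sum is at most [4 M] with [M] the largest of the four numbers, and [M^p] is one of the terms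
    on the right. *)
Lemma powR_sum4_le (x y z t p : R) : 0 <= x -> 0 <= y -> 0 <= z -> 0 <= t ->
  0 <= p -> (x + y + z + t) `^ p <= 4 `^ p * (x `^ p + y `^ p + z `^ p + t `^ p).
Proof.
move=> x0 y0 z0 t0 p0.
have [xp yp zp tp] : [/\ 0 <= x `^ p, 0 <= y `^ p, 0 <= z `^ p & 0 <= t `^ p].
  by split; exact: powR_ge0.
have key (M : R) : 0 <= M -> x <= M -> y <= M -> z <= M -> t <= M ->
    M `^ p <= x `^ p + y `^ p + z `^ p + t `^ p ->
    (x + y + z + t) `^ p <= 4 `^ p * (x `^ p + y `^ p + z `^ p + t `^ p).
  move=> M0 xM yM zM tM MS; apply: (@le_trans _ _ ((4 * M) `^ p)).
    by rewrite ge0_ler_powR ?nnegrE ?mulr_ge0 ?addr_ge0//; lra.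
  by rewrite powRM// ler_wpM2l ?powR_ge0.
have [xy|/ltW yx] := leP x y; have [zt|/ltW tz] := leP z t.
- by have [yt|/ltW ty] := leP y t; [apply: (key t)|apply: (key y)] => //; lra.
- by have [yt|/ltW ty] := leP y z; [apply: (key z)|apply: (key y)] => //; lra.
- by have [yt|/ltW ty] := leP x t; [apply: (key t)|apply: (key x)] => //; lra.
- by have [yt|/ltW ty] := leP x z; [apply: (key z)|apply: (key x)] => //; lra.
Qed.

(** Here [q] is the even order used for the exponent [p]. The constant is [64 = 16 * 4]: the
    quadratic term loses [4^2] in passing from [q] to [p], and the power of a sum of four terms
    loses 4. *)
Lemma moment_scale_powR_le p q a b c D : 0 < p -> 0 <= q <= 4 * p ->
  0 <= a -> 0 <= b -> 0 <= c -> 0 <= D ->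
  moment_scale q a b c D `^ p <= 64 `^ p *
    (p `^ (p / 2) * c `^ p + p `^ p * D `^ p + p `^ (3 * p / 2) * b `^ p +
     p `^ (2 * p) * a `^ p).
Proof.
move=> p0 /andP[q0 q4] a0 b0 c0 D0.
have p_ge0 := ltW p0.
set s := Num.sqrt p; have s0 : 0 <= s by exact: sqrtr_ge0.
have sq : Num.sqrt q <= 2 * s.
  rewrite (_ : 2 * s = Num.sqrt (4 * p)) ?ler_wsqrtr//.
  rewrite sqrtrM// (_ : 4 = 2 ^+ 2) ?sqrtr_sqr ?ger0_norm//; ring.
have H1 : Num.sqrt q * c <= 16 * (s * c).
  rewrite mulrA ler_wpM2r// (le_trans sq)// ler_wpM2r//; lra.
have H2 : q * D <= 16 * (p * D).
  rewrite mulrA ler_wpM2r// (le_trans q4)// ler_wpM2r//; lra.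
have H3 : Num.sqrt q ^+ 3 * b <= 16 * (s ^+ 3 * b).
  rewrite mulrA ler_wpM2r// (le_trans (expr_le 3 (sqrtr_ge0 _) sq))//.
  rewrite exprMn ler_wpM2r ?exprn_ge0//; lra.
have H4 : q ^+ 2 * a <= 16 * (p ^+ 2 * a).
  rewrite mulrA ler_wpM2r// (le_trans (expr_le 2 q0 q4))//.
  rewrite exprMn ler_wpM2r ?exprn_ge0//; lra.
have L16 : moment_scale q a b c D <= 16 * moment_scale p a b c D.
  rewrite /moment_scale -/s !mulrDr; by do !apply: lerD.
apply: (@le_trans _ _ ((16 * moment_scale p a b c D) `^ p)).
  by rewrite ge0_ler_powR ?nnegrE ?mulr_ge0 ?moment_scale_ge0.
have s_p : s `^ p = p `^ (p / 2).
  by rewrite /s -powR12_sqrt// -powRrM mulrC.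
have pw k : (s ^+ k) `^ p = p `^ (k%:R * p / 2).
  transitivity ((s `^ p) `^ k%:R).
    by rewrite -(powR_mulrn k s0) -!powRrM mulrC.
  by rewrite s_p -powRrM; congr (_ `^ _); ring.
have pw2 : (p ^+ 2) `^ p = p `^ (2 * p) by rewrite -powR_mulrn// -powRrM.
rewrite powRM ?moment_scale_ge0// (_ : 64 = 16 * 4); last by ring.
rewrite [(16 * 4) `^ p]powRM// -mulrA ler_wpM2l ?powR_ge0//.
rewrite /moment_scale -/s -s_p -(pw 3) -pw2 -!powRM ?exprn_ge0//.
by apply: powR_sum4_le; rewrite ?mulr_ge0 ?exprn_ge0.
Qed.

Lemma moment_cst_gt0 : 0 < moment_cst R.
Proof. by rewrite /moment_cst !mulr_gt0// expR_gt0. Qed.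

(** In the factor 8, 4 counts the terms of the scale and 2 gives a strict inequality; [expR 1] is
    the gain per order in Markov's inequality. The square is there because the [c] term grows only
    like the square root of the order. *)
Definition tail_cst : R := (8 * expR 1 * moment_cst R) ^+ 2.

(** The prefactor has to pay [e^4], the loss in rounding the moment order down to a multiple of
    4. *)
Lemma tail_cst_ge : expR 4 <= tail_cst.
Proof.
have e1 : 1 <= expR 1 :> R by have := expR_ge1Dx (1 : R); lra.
have e8 : expR 2 <= expR 8 :> R by rewrite ler_expR ler_nat.
have e0 := expR_ge0 (8 : R).
have e2 : 1 * expR 8 <= expR 1 * expR 8 :> R by rewrite ler_wpM2r.
have -> : expR 4 = expR 2 ^+ 2 :> R.
  by rewrite -expRM_natl; congr expR; ring.
apply: expr_le; first exact: expR_ge0.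
rewrite /moment_cst (_ : 8 * expR 1 * _ = 2560 * (expR 1 * expR 8)); last by ring.
lra.
Qed.

(** With [k = 8 * expR 1 * moment_cst R], each of the four terms of the scale is at most [x / k], so
    the left side is at most half of [x / expR 1]. *)
Lemma moment_scale_small p t x a b c D : 0 < x -> 0 <= p -> p * tail_cst <= t ->
  0 <= a -> 0 <= b -> 0 <= c -> 0 <= D ->
  t * c ^+ 2 <= x ^+ 2 -> t * D <= x -> t ^+ 3 * b ^+ 2 <= x ^+ 2 ->
  t ^+ 2 * a <= x -> moment_cst R * moment_scale p a b c D < x / expR 1.
Proof.
move=> x0 p0 pt a0 b0 c0 D0 hc hD hb ha.
set k := 8 * expR 1 * moment_cst R in pt *.
have K0_gt := moment_cst_gt0.
have e1 : 1 <= expR 1 :> R by have := expR_ge1Dx (1 : R); lra.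
have k1 : 1 <= k.
  have := tail_cst_ge; rewrite /tail_cst -/k => H.
  have : 1 <= expR 4 :> R by have := expR_ge1Dx (4 : R); lra.
  move=> /le_trans /(_ H); rewrite -[X in X <= _](expr1n _ 2) ler_pXn2r ?nnegrE//.
  by rewrite !mulr_ge0// ?expR_ge0 ?(ltW K0_gt).
have k0 : 0 < k by rewrite (lt_le_trans _ k1).
rewrite /tail_cst -/k in pt.
pose s := Num.sqrt p.
have s0 : 0 <= s by exact: sqrtr_ge0.
have s2 : s ^+ 2 = p by exact: sqr_sqrtr.
have pk0 : 0 <= p * k ^+ 2 by rewrite mulr_ge0 ?sqr_ge0.
have k2 : k <= k ^+ 2 by rewrite expr2 ler_peMl// ltW.
have H1 : s * c * k <= x.
  rewrite -(ler_pXn2r (ltn0Sn 1)) ?nnegrE ?mulr_ge0 ?(ltW k0) ?(ltW x0)//.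
  rewrite (_ : (s * c * k) ^+ 2 = p * k ^+ 2 * c ^+ 2); last by rewrite -s2; ring.
  by rewrite (le_trans _ hc)// ler_wpM2r ?sqr_ge0.
have H2 : p * D * k <= x.
  by rewrite (le_trans _ hD)// mulrAC ler_wpM2r// (le_trans _ pt)// ler_wpM2l.
have H3 : s ^+ 3 * b * k <= x.
  rewrite -(ler_pXn2r (ltn0Sn 1)) ?nnegrE ?mulr_ge0 ?exprn_ge0 ?(ltW k0) ?(ltW x0)//.
  rewrite (_ : (s ^+ 3 * b * k) ^+ 2 = p ^+ 3 * k ^+ 2 * b ^+ 2); last by rewrite
    -s2; ring.
  rewrite (le_trans _ hb)// ler_wpM2r ?sqr_ge0//.
  apply: (@le_trans _ _ ((p * k ^+ 2) ^+ 3)); last exact: expr_le.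
  rewrite [(p * _) ^+ _]exprMn ler_wpM2l ?exprn_ge0// -exprM.
  by apply: ler_weXn2l.
have H4 : p ^+ 2 * a * k <= x.
  rewrite (le_trans _ ha)// mulrAC ler_wpM2r//.
  apply: (@le_trans _ _ ((p * k ^+ 2) ^+ 2)); last exact: expr_le.
  rewrite [(p * _) ^+ _]exprMn ler_wpM2l ?exprn_ge0// -exprM -{1}(expr1 k).
  by apply: ler_weXn2l.
have H : k * moment_scale p a b c D <= 4 * x.
  have -> : k * moment_scale p a b c D = s * c * k + p * D * k + s ^+ 3 * b * k + p
    ^+ 2 * a * k.
    by rewrite /moment_scale -/s; ring.
  rewrite (_ : 4 * x = x + x + x + x); last by ring.
  by do !apply: lerD.
rewrite ltr_pdivlMr ?expR_gt0//.
have -> : moment_cst R * moment_scale p a b c D * expR 1 = k * moment_scale p a b c D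
  / 8 by rewrite /k; field.
lra.
Qed.

End LamBounds.

(** * The moment inequality and the tail inequality *)

Section Final.
Context {R : realType} {d d' : measure_display}.
Context {Omega : measurableType d} {S : measurableType d'}.
Variables (P : probability Omega R) (n : nat).
Variables (X1 X2 : 'I_n -> {RV P >-> S}) (h : 'I_n -> 'I_n -> S * S -> R).
Hypothesis indX : mutually_independent (family12 X1 X2).
Hypothesis mh : forall i j, measurable_fun setT (h i j).
Hypothesis boundh : bounded_kernels h.
Hypothesis canh : canonical_kernels X1 X2 h.

Let A := paramA h.
Let B := paramB X1 X2 h.
Let C := paramC X1 X2 h.
Let D := paramD X1 X2 h.

Lemma bmeas_Ustat : bmeas (Ustat X1 X2 h).
Proof.
do 2!apply: bmeas_sum => ?.
have bh i j : bmeas (h i j) by split.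
by apply: (bmeas_comp (bh _ _)); exact: measurable_fun_pair.
Qed.

Lemma real_exponent_moment (a b c e p : R) : A = a%:E -> B = b%:E -> C = c%:E ->
  D = e%:E -> 2 <= p ->
  \int[P]_w `|Ustat X1 X2 h w| `^ p <= (128 * moment_cst R) `^ p *
    (p `^ (p / 2) * c `^ p + p `^ p * e `^ p + p `^ (3 * p / 2) * b `^ p +
     p `^ (2 * p) * a `^ p).
Proof.
move=> hA hB hC hD p2.
have a0 : 0 <= a by rewrite -lee_fin -hA paramA_ge0.
have b0 : 0 <= b by rewrite -lee_fin -hB paramB_ge0.
have c0 : 0 <= c by rewrite -lee_fin -hC paramC_ge0.
have e0 : 0 <= e by rewrite -lee_fin -hD paramD_ge0.
have p0 : 0 < p by rewrite (lt_le_trans _ p2).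
(* [m] is the first multiple of 4 above [p], so [m <= p + 4 <= 4 p] because [p >= 2]. *)
pose r := (Num.truncn (p / 4)).+1; pose m := (2 * (2 * r))%N.
have /andP[r1 r2] : (Num.truncn (p / 4))%:R <= p / 4 < r%:R.
  by apply: truncn_itv; rewrite divr_ge0// ltW.
have mE : m%:R = 4 * r%:R :> R by rewrite /m !natrM; ring.
have pm : p <= m%:R by rewrite mE; lra.
have mp : m%:R <= 4 * p.
  by rewrite mE /r -(natr1 (Num.truncn _)); lra.
have em : ~~ odd m by rewrite /m mul2n odd_double.
have K0g := @moment_cst_gt0 R.
have L0 : 0 <= moment_cst R * moment_scale m%:R a b c e by rewrite mulr_ge0
  ?moment_scale_ge0// ltW.
apply: (le_trans (real_moment_le bmeas_Ustat p0 pm em L0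
  (fun L => even_moment indX mh boundh canh (ltn0Sn _) hA hB hC hD))).
rewrite powRM ?moment_scale_ge0 ?(ltW K0g)//.
have mq : (0 : R) <= m%:R <= 4 * p by rewrite ler0n mp.
have := moment_scale_powR_le p0 mq a0 b0 c0 e0; set Q := _ + _ => lQ.
have Q0 : 0 <= Q by rewrite !addr_ge0// mulr_ge0 ?powR_ge0.
(* The factor 2 from interpolation goes into the [p]-th power, which gives [128 = 2 * 64]. *)
have two : 2 <= 2 `^ p.
  by rewrite -[leLHS]powRr1// ler_powR ?ler1n// (le_trans _ p2)// ler1n.
have Kp : 0 <= moment_cst R `^ p by exact: powR_ge0.
apply: (@le_trans _ _ (2 `^ p * (moment_cst R `^ p * (64 `^ p * Q)))).
  apply: ler_pM => //; first by rewrite mulr_ge0 ?powR_ge0.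
  exact: ler_wpM2l.
rewrite (_ : 128 * moment_cst R = 2 * moment_cst R * 64); last by ring.
by rewrite !powRM ?mulr_ge0 ?(ltW K0g)// !mulrA.
Qed.

(** The last four hypotheses say, cleared of denominators and fractional powers, that [t] is at most
    the rate. Markov's inequality at an order [m] close to [t / tail_cst] then gains [e^(-m)]. *)
Lemma real_tail (a b c e x t : R) : A = a%:E -> B = b%:E -> C = c%:E ->
  D = e%:E -> 0 < x -> 0 <= t ->
  t * c ^+ 2 <= x ^+ 2 -> t * e <= x -> t ^+ 3 * b ^+ 2 <= x ^+ 2 ->
  t ^+ 2 * a <= x ->
  (P [set w | (x <= `|Ustat X1 X2 h w|)%R] <=
   (tail_cst * expR (- (t / tail_cst)))%R%:E)%E.
Proof.
move=> hA hB hC hD x0 t0 tc te tb ta.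
have a0 : 0 <= a by rewrite -lee_fin -hA paramA_ge0.
have b0 : 0 <= b by rewrite -lee_fin -hB paramB_ge0.
have c0 : 0 <= c by rewrite -lee_fin -hC paramC_ge0.
have e0 : 0 <= e by rewrite -lee_fin -hD paramD_ge0.
have L4 := @tail_cst_ge R; set L := tail_cst in L4 *.
have Lg : 0 < L by rewrite (lt_le_trans _ L4) ?expR_gt0.
pose u := t / L; have u0 : 0 <= u by rewrite divr_ge0// ltW.
have goal4 : expR (4 - u) <= L * expR (- (t / L)).
  by rewrite expRD ler_wpM2r ?expR_ge0.
(* For [u < 4] no positive order is available, but the bound then exceeds 1. *)
have [u4|u4] := ltP u 4.
  apply: (le_trans (probability_le1 _ _)) => //.
    exact/measurable_norm_ge/bmeas_Ustat.
  rewrite lee_fin (le_trans _ goal4)//.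
  by have := expR_ge1Dx (4 - u); lra.
(* [m = 4 k] is the largest multiple of 4 not above [u], so [m > u - 4]. *)
pose k := Num.truncn (u / 4); pose m := (2 * (2 * k))%N.
have /andP[k1 k2] : k%:R <= u / 4 < k.+1%:R.
  by apply: truncn_itv; rewrite divr_ge0.
have k0 : (0 < k)%N by rewrite -(ltr0n R) ; move: k2; rewrite -(natr1 k); lra.
have mE : m%:R = 4 * k%:R :> R by rewrite /m !natrM; ring.
have em : ~~ odd m by rewrite /m mul2n odd_double.
have mt : m%:R * L <= t by rewrite -ler_pdivlMr// mE -/u; lra.
have KL := moment_scale_small x0 (ler0n _ m) mt a0 b0 c0 e0 tc te tb ta.
have H := even_moment indX mh boundh canh k0 hA hB hC hD KL.
apply: (le_trans (markov_even P bmeas_Ustat x0 em)); rewrite lee_fin.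
rewrite (le_trans _ goal4)// ler_pdivrMr ?exprn_gt0// (le_trans H)//.
rewrite exprMn mulrC ler_wpM2r ?exprn_ge0 ?(ltW x0)// exprVn -expRM_natl mulr1 -expRN.
by rewrite ler_expR mE; move: k2; rewrite -(natr1 k); lra.
Qed.

(** An infinite [z] would make the quotient 0, below [t]; for [z = 0] the conclusion is just
    [0 <= y]. *)
Lemma le_div_fin (t y : R) (z : \bar R) : 0 < t -> 0 <= y -> (0 <= z)%E ->
  (t%:E <= y%:E / z)%E -> exists2 r, z = r%:E & t * r <= y.
Proof.
move=> t0 y0; case: z => [r||] //.
- rewrite lee_fin => r0 H; exists r => //; move: H; rewrite inver.
  have [->|rn0] := eqVneq r 0; first by rewrite mulr0.
  by rewrite -EFinM lee_fin ler_pdivlMr// lt_neqAle eq_sym rn0.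
- by move=> _; rewrite invey mule0 lee_fin leNgt t0.
Qed.

(** For [t = 0] the bound is at least 1. A positive [t] below the rate forces all four parameters to
    be finite, and the fractional powers are removed by cubing and squaring. *)
Lemma tail_rate_le (x t : R) : 0 < x -> 0 <= t ->
  (t%:E <= tail_rate X1 X2 h x)%E ->
  (P [set w | (x <= `|Ustat X1 X2 h w|)%R] <=
   (tail_cst * expR (- (t / tail_cst)))%R%:E)%E.
Proof.
move=> x0; rewrite le_eqVlt => /predU1P[<- _|t0].
  rewrite mul0r oppr0 expR0 mulr1 (le_trans (probability_le1 _ _))//.
    exact/measurable_norm_ge/bmeas_Ustat.
  rewrite lee_fin (le_trans _ (@tail_cst_ge R))//.
  by have := expR_ge1Dx (4 : R); lra.
rewrite /tail_rate !le_min -/A -/B -/C -/D => /andP[/andP[hC hD] /andP[hB hA]].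
have A0 : (0 <= A)%E by exact: paramA_ge0.
have B0 : (0 <= B)%E by exact: paramB_ge0.
have C0 : (0 <= C)%E by exact: paramC_ge0.
have D0 : (0 <= D)%E by exact: paramD_ge0.
have [c2 cE tc] := le_div_fin t0 (sqr_ge0 x) (expe_ge0 2 C0) hC.
have [e eE te] := le_div_fin t0 (ltW x0) D0 hD.
have [b' bE tb] := le_div_fin t0 (powR_ge0 _ _) (poweR_ge0 _ _) hB.
have [a' aE ta] := le_div_fin t0 (powR_ge0 _ _) (poweR_ge0 _ _) hA.
have [c CE] : exists c, C = c%:E.
  by move: C0 cE; case: (C) => [c||] //; exists c.
have [b BE] : exists b, B = b%:E.
  move: B0 bE; case: (B) => [b||] //; first by exists b.
  by rewrite poweRyr// gt_eqF.
have [a AE] : exists a, A = a%:E.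
  move: A0 aE; case: (A) => [a||] //; first by exists a.
  by rewrite poweRyr// gt_eqF.
have b0 : 0 <= b by rewrite -lee_fin -BE.
have a0 : 0 <= a by rewrite -lee_fin -AE.
move: cE bE aE; rewrite CE BE AE !poweR_EFin -EFin_expe => -[cE] [bE] [aE].
apply: (real_tail AE BE CE eE x0 (ltW t0)) => //.
- by rewrite cE.
- have pw (y : R) : 0 <= y -> y ^+ 2 = (y `^ (2 / 3)) ^+ 3.
    move=> y0; rewrite -[RHS]powR_mulrn ?powR_ge0// -powRrM -(powR_mulrn 2 y0).
    by congr (_ `^ _); field.
  rewrite (pw b b0) (pw x (ltW x0)) bE -exprMn; apply: expr_le => //.
  by rewrite mulr_ge0 ?(ltW t0)// -bE powR_ge0.
- have pw (y : R) : 0 <= y -> y = (y `^ (1 / 2)) ^+ 2.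
    move=> y0; rewrite -[RHS]powR_mulrn ?powR_ge0// -powRrM -[LHS](powRr1 y0).
    by congr (_ `^ _); field.
  rewrite (pw a a0) (pw x (ltW x0)) aE -exprMn; apply: expr_le => //.
  by rewrite mulr_ge0 ?(ltW t0)// -aE powR_ge0.
Qed.

Lemma moment_inequality (p : R) : 2 <= p ->
  ('E_P[fun w => (`|Ustat X1 X2 h w| `^ p)%R] <=
   ((128 * moment_cst R) `^ p)%:E * moment_bound X1 X2 h p)%E.
Proof.
move=> p2; have p0 : 0 < p by rewrite (lt_le_trans _ p2).
have pn0 : p != 0 by rewrite gt_eqF.
have K0g : 0 < (128 * moment_cst R) `^ p by rewrite powR_gt0// mulr_gt0//
  moment_cst_gt0.
have A0 : (0 <= A)%E by exact: paramA_ge0.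
have B0 : (0 <= B)%E by exact: paramB_ge0.
have C0 : (0 <= C)%E by exact: paramC_ge0.
have D0 : (0 <= D)%E by exact: paramD_ge0.
have Tge0 q (z : \bar R) : (0 <= (p `^ q)%:E * z `^ p)%E.
  by rewrite mule_ge0 ?poweR_ge0// lee_fin powR_ge0.
have Ty q : ((p `^ q)%:E * +oo `^ p = +oo)%E.
  by rewrite poweRyr// gt0_muley// lte_fin powR_gt0.
(* One infinite parameter makes the whole bound infinite, as every coefficient is positive and every
   term nonnegative. *)
have fin : moment_bound X1 X2 h p = +oo%E \/
    exists a b c e, [/\ A = a%:E, B = b%:E, C = c%:E & D = e%:E].
  rewrite /moment_bound -/A -/B -/C -/D.
  move: A0 B0 C0 D0; case: (A) => [a||] //; case: (B) => [b||] //;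
    case: (C) => [c||] //; case: (D) => [e||] //; rewrite ?Ty => _ _ _ _;
    try by left; rewrite ?poweR_EFin -?EFinM -?EFinD ?addey ?addye.
  by right; exists a, b, c, e.
case: fin => [->|[a [b [c [e [hA hB hC hD]]]]]].
  by rewrite gt0_muley ?lte_fin// leey.
rewrite expectation_mean; last exact: bmeas_powR bmeas_Ustat (ltW p0).
rewrite /moment_bound -/A -/B -/C -/D hA hB hC hD !poweR_EFin -!EFinM.
by rewrite lee_fin; exact: real_exponent_moment.
Qed.

Lemma tail_inequality (x : R) : 0 < x ->
  (P [set w | (x <= `|Ustat X1 X2 h w|)%R] <=
   tail_cst%:E * expeR (- ((tail_cst^-1)%:E * tail_rate X1 X2 h x)))%E.
Proof.
move=> x0; have H := tail_rate_le x0.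
have Lg : 0 < tail_cst :> R by rewrite (lt_le_trans _ (@tail_cst_ge R)) ?expR_gt0.
have rate0 : (0 <= tail_rate X1 X2 h x)%E.
  rewrite /tail_rate !le_min; apply/andP; split; apply/andP; split;
    rewrite mule_ge0 ?inve_ge0 ?expe_ge0 ?poweR_ge0 ?lee_fin ?powR_ge0 ?sqr_ge0 ?(ltW
      x0)//.
  - exact: paramC_ge0.
  - exact: paramD_ge0.
move: rate0 H; case: (tail_rate X1 X2 h x) => [r||] //= => [r0 H|_ H].
  by rewrite -EFinM [(_ * r)%R]mulrC; apply: H => //; rewrite lexx.
(* For an infinite rate the probability must vanish: the bound holds for every [t], and this choice
   of [t] makes it at most [v], because [expR y >= y] at [y = tail_cst / v]. *)
rewrite gt0_muley ?lte_fin ?invr_gt0//= mule0.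
apply/lee_addgt0Pr => v v0; rewrite add0e.
pose t : R := tail_cst * (tail_cst / v).
have t0 : 0 <= t by rewrite mulr_ge0 ?divr_ge0 ?ltW.
apply: (le_trans (H t t0 (leey _))); rewrite lee_fin.
have -> : t / tail_cst = tail_cst / v by rewrite /t; field; rewrite !gt_eqF.
rewrite expRN ler_pdivrMr ?expR_gt0// -ler_pdivrMl//.
by rewrite mulrC (le_trans _ (expR_ge1Dx _))// lerDr.
Qed.

End Final.

Theorem theorem3p3 (R : realType) :
  exists K L : R, 0 < K /\ 0 < L /\
  forall (d d' : measure_display) (Omega : measurableType d)
    (S : measurableType d') (P : probability Omega R) (n : nat)
    (X1 X2 : 'I_n -> {RV P >-> S}) (h : 'I_n -> 'I_n -> S * S -> R),
  mutually_independent (family12 X1 X2) ->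
  (forall i j, measurable_fun setT (h i j)) ->
  bounded_kernels h ->
  canonical_kernels X1 X2 h ->
  (forall p : R, 2 <= p ->
    ('E_P[fun w => (`|Ustat X1 X2 h w| `^ p)%R]
       <= (K `^ p)%:E * moment_bound X1 X2 h p)%E) /\
  (forall x : R, 0 < x ->
    (P [set w | (x <= `|Ustat X1 X2 h w|)%R]
       <= L%:E * expeR (- ((L^-1)%:E * tail_rate X1 X2 h x)))%E).
Proof.
exists (128 * moment_cst R), tail_cst; split; first by rewrite mulr_gt0//
  moment_cst_gt0.
split; first by rewrite (lt_le_trans _ (@tail_cst_ge R)) ?expR_gt0.
move=> d d' Omega S P n X1 X2 h indX mh boundh canh.
by split=> [p p2|x x0]; [exact: moment_inequality|exact: tail_inequality].
Qed.
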